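(* Let $h_n>0$, $T=nh_n$ and $\alpha\in(0,1)$. Assume that each of the drifts $B_1,\dots,B_4$ is globally Lipschitz and of class $C^4$ with all partial derivatives of order $0$ to $4$ of polynomial growth, that $\sup_{t}\mathbb{E}[|Y_t|^{\ell}]<\infty$ for all $\ell\ge 0$ and each $Y\in\{\xi_0,\delta_0,\varepsilon_0,\zeta_0\}$, and that each such $Y$ is ergodic with an invariant measure $\pi_Y$: for every $\pi_Y$-integrable $g$, $\frac1T\int_0^Tg(Y_t)dt\to\int g\,d\pi_Y$ in probability as $T\to\infty$. Assume $H_1$: $\mathbf{\Sigma}_0\ne\mathbf{\Sigma}(\theta)$ for every $\theta\in\Theta$. Suppose that $\mathbb{U}(\theta)=\mathrm{F}(\mathbf{\Sigma}_0,\mathbf{\Sigma}(\theta))$ has a unique minimizer $\bar\theta$ on $\Theta$, that the Hessian $\partial_\theta^2\mathbb{U}(\bar\theta)$ is non-singular, and that $0<\delta<\min_{j\in\bar{\mathcal{F}}_1}|\bar\theta^{(j)}|$, where $\bar{\mathcal{F}}_1=\{j:\bar\theta^{(j)}\ne0\}$. Then, as $h_n\to0$, $nh_n\to\infty$, $nh_n^2\to0$, $\sqrt n\lambda_{1,n}\to0$ and $\sqrt n\lambda_{2,n}\to\infty$, with $\check{\mathbb{T}}_n=n\mathbb{F}_n(\check\theta_n)$, $$\mathbb{P}\Bigl(\check{\mathbb{T}}_n>\chi^2_{\bar p-|\tilde{\mathcal{F}}_{\mathbb{I},n,1}|}(\alpha)\Bigr)\to1.$$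
   Context: Notation: $\operatorname{vech}$ is half-vectorization; $v^{(j)}$ is the $j$-th coordinate of $v$; $|S|$ is the cardinality of a set $S$; $\chi^2_r(\alpha)$ is the upper $\alpha$ point of the chi-squared distribution with $r$ degrees of freedom (degrees of freedom are understood to be positive). True model and data: $p_1,p_2,k_1,k_2,r_1,\dots,r_4\ge 1$ are fixed integers with $k_1\le p_1$, $k_2\le p_2$; $p=p_1+p_2$, $\bar p=p(p+1)/2$. $W_1,\dots,W_4$ are independent standard Wiener processes of dimensions $r_1,\dots,r_4$. The latent processes $\xi_0,\delta_0,\varepsilon_0,\zeta_0$, with values in $\mathbb{R}^{k_1},\mathbb{R}^{p_1},\mathbb{R}^{p_2},\mathbb{R}^{k_2}$, solve for $t\ge0$: $d\xi_{0,t}=B_1(\xi_{0,t})dt+\mathbf{S}_{1,0}dW_{1,t}$, $d\delta_{0,t}=B_2(\delta_{0,t})dt+\mathbf{S}_{2,0}dW_{2,t}$, $d\varepsilon_{0,t}=B_3(\varepsilon_{0,t})dt+\mathbf{S}_{3,0}dW_{3,t}$, $d\zeta_{0,t}=B_4(\zeta_{0,t})dt+\mathbf{S}_{4,0}dW_{4,t}$, with deterministic initial values $c_1,\dots,c_4$ and constant matrices $\mathbf{S}_{i,0}$. Put $\mathbf{\Sigma}_{\xi\xi,0}=\mathbf{S}_{1,0}\mathbf{S}_{1,0}^\top$, $\mathbf{\Sigma}_{\delta\delta,0}=\mathbf{S}_{2,0}\mathbf{S}_{2,0}^\top$, $\mathbf{\Sigma}_{\varepsilon\varepsilon,0}=\mathbf{S}_{3,0}\mathbf{S}_{3,0}^\top$,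 $\mathbf{\Sigma}_{\zeta\zeta,0}=\mathbf{S}_{4,0}\mathbf{S}_{4,0}^\top$; $\mathbf{\Sigma}_{\delta\delta,0}$ and $\mathbf{\Sigma}_{\varepsilon\varepsilon,0}$ are positive definite. Constant matrices: $\mathbf{\Lambda}_{x_1,0}\in\mathbb{R}^{p_1\times k_1}$ of full column rank, $\mathbf{\Lambda}_{x_2,0}\in\mathbb{R}^{p_2\times k_2}$, $\mathbf{\Gamma}_0\in\mathbb{R}^{k_2\times k_1}$, $\mathbf{B}_0\in\mathbb{R}^{k_2\times k_2}$ with zero diagonal, $\mathbf{\Psi}_0=\mathbb{I}_{k_2}-\mathbf{B}_0$ non-singular. The observed process is $\mathbb{X}_t=(\mathbb{X}_{1,t}^\top,\mathbb{X}_{2,t}^\top)^\top$ with $\mathbb{X}_{1,t}=\mathbf{\Lambda}_{x_1,0}\xi_{0,t}+\delta_{0,t}$, $\mathbb{X}_{2,t}=\mathbf{\Lambda}_{x_2,0}\eta_{0,t}+\varepsilon_{0,t}$, $\eta_{0,t}=\mathbf{B}_0\eta_{0,t}+\mathbf{\Gamma}_0\xi_{0,t}+\zeta_{0,t}$. With $t_i^n=ih_n$, $T=nh_n$, $\mathbb{Q}_{\mathbb{XX}}=\frac1T\sum_{i=1}^n(\mathbb{X}_{t_i^n}-\mathbb{X}_{t_{i-1}^n})(\mathbb{X}_{t_i^n}-\mathbb{X}_{t_{i-1}^n})^\top$. Parametric model: $\Theta\subset\mathbb{R}^q$ is convex and compact. For $\theta\in\Theta$ there are matrices $\mathbf{\Lambda}_{x_1},\mathbf{\Lambda}_{x_2},\mathbf{\Gamma},\mathbf{\Psi}=\mathbb{I}_{k_2}-\mathbf{B}$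 ($\mathbf{B}$ with zero diagonal), $\mathbf{\Sigma}_{\xi\xi},\mathbf{\Sigma}_{\delta\delta},\mathbf{\Sigma}_{\varepsilon\varepsilon},\mathbf{\Sigma}_{\zeta\zeta}$ of respective sizes $p_1\times k_1$, $p_2\times k_2$, $k_2\times k_1$, $k_2\times k_2$, $k_1\times k_1$, $p_1\times p_1$, $p_2\times p_2$, $k_2\times k_2$, each entry being either a known constant or a coordinate of $\theta$ ($\theta$ collects the unknown, non-duplicated entries); $\mathbf{\Lambda}_{x_1}$ has full column rank, $\mathbf{\Psi}$ is non-singular, $\mathbf{\Sigma}_{\xi\xi},\mathbf{\Sigma}_{\zeta\zeta}$ are positive semidefinite, $\mathbf{\Sigma}_{\delta\delta},\mathbf{\Sigma}_{\varepsilon\varepsilon}$ positive definite. $\mathbf{\Sigma}(\theta)$ is the symmetric $p\times p$ matrix with blocks $\mathbf{\Sigma}^{11}=\mathbf{\Lambda}_{x_1}\mathbf{\Sigma}_{\xi\xi}\mathbf{\Lambda}_{x_1}^\top+\mathbf{\Sigma}_{\delta\delta}$, $\mathbf{\Sigma}^{12}=\mathbf{\Lambda}_{x_1}\mathbf{\Sigma}_{\xi\xi}\mathbf{\Gamma}^\top\mathbf{\Psi}^{-1\top}\mathbf{\Lambda}_{x_2}^\top$, $\mathbf{\Sigma}^{22}=\mathbf{\Lambda}_{x_2}\mathbf{\Psi}^{-1}(\mathbf{\Gamma}\mathbf{\Sigma}_{\xi\xi}\mathbf{\Gamma}^\top+\mathbf{\Sigma}_{\zeta\zeta})\mathbf{\Psi}^{-1\top}\mathbf{\Lambda}_{x_2}^\top+\mathbf{\Sigma}_{\varepsilon\varepsilon}$;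 $\mathbf{\Sigma}_0$ is the same expression evaluated at the true matrices (subscript $0$). Contrast and estimator: $\mathrm{F}(Q,\mathbf{\Sigma})=\log\det\mathbf{\Sigma}-\log\det Q+\operatorname{tr}(\mathbf{\Sigma}^{-1}Q)-p$ for $Q,\mathbf{\Sigma}$ positive definite. $\mathbb{F}_n(\theta)=\mathrm{F}(\mathbb{Q}_{\mathbb{XX}},\mathbf{\Sigma}(\theta))$ if $\mathbb{Q}_{\mathbb{XX}}$ is non-singular and $\mathbb{F}_n(\theta)=|\operatorname{vech}\mathbb{Q}_{\mathbb{XX}}-\operatorname{vech}\mathbf{\Sigma}(\theta)|^2$ otherwise. $\hat\theta_n\in\Theta$ satisfies $\mathbb{F}_n(\hat\theta_n)=\inf_{\theta\in\Theta}\mathbb{F}_n(\theta)$. Sparse estimation: $\lambda_{1,n},\lambda_{2,n},\gamma,\delta>0$ are deterministic tuning constants (the scalar $\delta$ is unrelated to the process $\delta_0$). $\kappa_n^{(j)}=\lambda_{1,n}|\hat\theta_n^{(j)}|^{-\gamma}1_{\{|\hat\theta_n^{(j)}|\ge\delta\}}+\lambda_{2,n}1_{\{|\hat\theta_n^{(j)}|<\delta\}}$, $j=1,\dots,q$. $\tilde\theta_{\mathbb{I},n}\in\Theta$ minimizes $\mathbb{Q}_{\mathbb{I},n}(\theta)=\sum_{j=1}^q(\theta^{(j)}-\hat\theta_n^{(j)})^2+\sum_{j=1}^q\kappa_n^{(j)}|\theta^{(j)}|$ over $\Theta$; $\tilde{\mathcal{F}}_{\mathbb{I},n,1}=\{j:\tilde\theta^{(j)}_{\mathbb{I},n}\ne0\}$.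 $\tilde\Theta_n=\{\theta\in\Theta:\theta^{(j)}=0\text{ for all }j\text{ with }\tilde\theta^{(j)}_{\mathbb{I},n}=0\}$, and the P-O estimator $\check\theta_n\in\tilde\Theta_n$ satisfies $\mathbb{F}_n(\check\theta_n)=\inf_{\theta\in\tilde\Theta_n}\mathbb{F}_n(\theta)$. *)

(* Defs.v *)
From HB Require Import structures.
From mathcomp Require Import all_boot all_order all_algebra.
From mathcomp Require Import all_classical all_reals all_analysis.

Set Implicit Arguments.
Unset Strict Implicit.
Unset Printing Implicit Defensive.

Import Order.TTheory GRing.Theory Num.Theory.
Import numFieldNormedType.Exports.

Local Open Scope classical_set_scope.
Local Open Scope ring_scope.

Section LinearAlgebra.
Context {R : realType}.

(* The library norm on matrices is the sup norm, hence this one. *)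
Definition enorm n (v : 'cV[R]_n) : R := Num.sqrt (\sum_i v i 0 ^+ 2).

Definition psdmx n (A : 'M[R]_n) : Prop :=
  A^T = A /\ forall x : 'cV[R]_n, 0 <= (x^T *m A *m x) 0 0.

Definition pdmx n (A : 'M[R]_n) : Prop :=
  A^T = A /\ forall x : 'cV[R]_n, x != 0 -> 0 < (x^T *m A *m x) 0 0.

(* Positions are enumerated as pairs (column, row) in lexicographic order, so
   that [vech] stacks the columns of the lower triangle. *)
Definition vech_pos n := [pred ji : 'I_n * 'I_n | (ji.1 <= ji.2)%N].

Definition vech n (A : 'M[R]_n) : 'cV[R]_#|vech_pos n| :=
  \col_k A (enum_val k).2 (enum_val k).1.

End LinearAlgebra.

Definition is_minimizer {R : realType} {T : Type} (f : T -> R) (A : set T)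
    (x : T) : Prop :=
  A x /\ forall y, A y -> f x <= f y.

Section ChiSquared.
Context {R : realType}.

Definition Gamma (s : R) : R :=
  (\int[lebesgue_measure]_(x in `]0%R, +oo[) (x `^ (s - 1) * expR (- x)))%R.

Definition chi2_pdf (r : nat) (x : R) : R :=
  if 0 < x then
    x `^ (r%:R / 2 - 1) * expR (- x / 2) / (2 `^ (r%:R / 2) * Gamma (r%:R / 2))
  else 0.

Definition chi2_tail (r : nat) (x : R) : \bar R :=
  (\int[lebesgue_measure]_(y in `]x, +oo[) (chi2_pdf r y)%:E)%E.

(* For 0 < r and 0 < alpha < 1 there is exactly one such point; the value for
   r = 0, where there is none, is irrelevant. *)
Definition chi2_upper (r : nat) (alpha : R) : R :=
  xget 0 [set x | chi2_tail r x = alpha%:E].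

End ChiSquared.

Section StructuralEquationModel.
Context {R : realType}.

Record sem (T : Type) (p1 p2 k1 k2 : nat) := Sem {
  Lx1 : 'M[T]_(p1, k1);
  Lx2 : 'M[T]_(p2, k2);
  Gam : 'M[T]_(k2, k1);
  Psi : 'M[T]_k2;
  Sxi : 'M[T]_k1;
  Sdelta : 'M[T]_p1;
  Seps : 'M[T]_p2;
  Szeta : 'M[T]_k2 }.

Definition sem_map (T T' : Type) (f : T -> T') p1 p2 k1 k2
    (s : sem T p1 p2 k1 k2) : sem T' p1 p2 k1 k2 :=
  Sem (map_mx f (Lx1 s)) (map_mx f (Lx2 s)) (map_mx f (Gam s))
    (map_mx f (Psi s)) (map_mx f (Sxi s)) (map_mx f (Sdelta s))
    (map_mx f (Seps s)) (map_mx f (Szeta s)).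

Context {p1 p2 k1 k2 : nat}.

Definition sem_admissible (s : sem R p1 p2 k1 k2) : Prop :=
  [/\ \rank (Lx1 s) = k1,
      (forall i, (1%:M - Psi s) i i = 0) /\ Psi s \in unitmx,
      psdmx (Sxi s) /\ psdmx (Szeta s) &
      pdmx (Sdelta s) /\ pdmx (Seps s)].

Definition Sigma (s : sem R p1 p2 k1 k2) : 'M[R]_(p1 + p2) :=
  let iPsi := invmx (Psi s) in
  let S11 := Lx1 s *m Sxi s *m (Lx1 s)^T + Sdelta s in
  let S12 := Lx1 s *m Sxi s *m (Gam s)^T *m iPsi^T *m (Lx2 s)^T in
  let S22 := Lx2 s *m iPsi *m (Gam s *m Sxi s *m (Gam s)^T + Szeta s)
               *m iPsi^T *m (Lx2 s)^T + Seps s in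
  block_mx S11 S12 S12^T S22.

(* An entry of a parametric model is a known constant [inl c] or the
   coordinate [inr j] of the parameter. *)
Definition sem_template (q : nat) := sem (R + 'I_q)%type p1 p2 k1 k2.

Definition entry_at q (theta : 'rV[R]_q) (e : R + 'I_q) : R :=
  match e with inl c => c | inr j => theta 0 j end.

Definition sem_at q (M : sem_template q) (theta : 'rV[R]_q) :
    sem R p1 p2 k1 k2 :=
  sem_map (entry_at theta) M.

Definition has_entry q m n (A : 'M[(R + 'I_q)%type]_(m, n)) (j : 'I_q) : Prop :=
  exists i k, A i k = inr j.

Definition template_wf q (M : sem_template q) : Prop :=
  [/\ (Sxi M)^T = Sxi M, (Sdelta M)^T = Sdelta M, (Seps M)^T = Seps M,
      (Szeta M)^T = Szeta M &
      forall j, has_entry (Lx1 M) j \/ has_entry (Lx2 M) j \/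
        has_entry (Gam M) j \/ has_entry (Psi M) j \/ has_entry (Sxi M) j \/
        has_entry (Sdelta M) j \/ has_entry (Seps M) j \/ has_entry (Szeta M) j].

End StructuralEquationModel.

Arguments sem_template R p1 p2 k1 k2 q : clear implicits.

Section Contrast.
Context {R : realType}.

Definition contrast p (Q S : 'M[R]_p) : R :=
  ln (\det S) - ln (\det Q) + \tr (invmx S *m Q) - p%:R.

Definition empirical_contrast p (Q S : 'M[R]_p) : R :=
  if Q \in unitmx then contrast Q S else enorm (vech Q - vech S) ^+ 2.

Definition hessian q (f : 'rV[R]_q -> R) (theta : 'rV[R]_q) : 'M[R]_q :=
  \matrix_(i, j) 'D_(delta_mx 0 i) ('D_(delta_mx 0 j) f) theta.

Definition realized_cov p (h : R) (n : nat) (x : R -> 'cV[R]_p) : 'M[R]_p :=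
  (n%:R * h)^-1 *:
    \sum_(i < n) (x (i.+1%:R * h) - x (i%:R * h)) *m
                 (x (i.+1%:R * h) - x (i%:R * h))^T.

Definition penalty_weight q (l1 l2 gamma delta : R) (hat : 'rV[R]_q) (j : 'I_q)
    : R :=
  if delta <= `|hat 0 j| then l1 * `|hat 0 j| `^ (- gamma) else l2.

Definition penalized_ls q (l1 l2 gamma delta : R) (hat theta : 'rV[R]_q) : R :=
  \sum_j (theta 0 j - hat 0 j) ^+ 2 +
  \sum_j penalty_weight l1 l2 gamma delta hat j * `|theta 0 j|.

Definition active q (theta : 'rV[R]_q) : {set 'I_q} :=
  [set j | theta 0 j != 0]%SET.

Definition restrict_support q (Theta : set 'rV[R]_q) (theta0 : 'rV[R]_q) :
    set 'rV[R]_q :=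
  [set theta | Theta theta /\ forall j, theta0 0 j = 0 -> theta 0 j = 0].

End Contrast.

Section Drift.
Context {R : realType} {k : nat}.

Definition partials (s : seq 'I_k) (f : 'cV[R]_k -> R) : 'cV[R]_k -> R :=
  foldr (fun i g => 'D_(delta_mx i 0) g) f s.

Definition polynomial_growth (f : 'cV[R]_k -> R) : Prop :=
  exists (C : R) (m : nat), forall x, `|f x| <= C * (1 + enorm x) ^+ m.

Definition class_C (n : nat) (f : 'cV[R]_k -> R) : Prop :=
  forall s : seq 'I_k, (size s <= n)%N ->
    continuous (partials s f) /\
    ((size s < n)%N ->
       forall i x, derivable (partials s f) x (delta_mx i 0)).

Definition regular_drift (B : 'cV[R]_k -> 'cV[R]_k) : Prop :=
  lipschitz B /\
  forall j, class_C 4 (fun x => B x j 0) /\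
    forall s : seq 'I_k, (size s <= 4)%N ->
      polynomial_growth (partials s (fun x => B x j 0)).

End Drift.

Section Processes.
Context {d : measure_display} {Omega : measurableType d} {R : realType}.
Variable P : probability Omega R.

Definition random_vector m n (X : Omega -> 'M[R]_(m, n)) : Prop :=
  forall i j, measurable_fun setT (fun w => X w i j).

Definition continuous_path n (y : R -> 'cV[R]_n) : Prop :=
  {within `[0%R, +oo[, continuous y}.

(* The product rule covers at once the Gaussian law of the increments, their
   independence and the independence of the coordinates. *)
Definition standard_wiener r (W : R -> Omega -> 'cV[R]_r) : Prop :=
  [/\ forall t, 0 <= t -> random_vector (W t),
      {ae P, forall w, W 0 w = 0 /\ continuous_path (W ^~ w)} &
      forall (m : nat) (t : nat -> R), 0 <= t 0%N ->
        (forall i, (i < m)%N -> t i < t i.+1) ->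
        forall A : 'I_m -> 'I_r -> set R, (forall i j, measurable (A i j)) ->
          P [set w | forall (i : 'I_m) (j : 'I_r),
                       A i j (W (t i.+1) w j 0 - W (t i) w j 0)] =
          (\prod_(i < m) \prod_(j < r)
             normal_prob 0%R (Num.sqrt (t i.+1 - t i)) (A i j))%E].

Definition sigma_process r (W : R -> Omega -> 'cV[R]_r) : set (set Omega) :=
  <<s [set E | exists t j (A : set R),
         [/\ 0 <= t, measurable A & E = (fun w => W t w j 0) @^-1` A]] >>.

Definition independent4 r1 r2 r3 r4
    (W1 : R -> Omega -> 'cV[R]_r1) (W2 : R -> Omega -> 'cV[R]_r2)
    (W3 : R -> Omega -> 'cV[R]_r3) (W4 : R -> Omega -> 'cV[R]_r4) : Prop :=
  forall E1 E2 E3 E4, sigma_process W1 E1 -> sigma_process W2 E2 ->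
    sigma_process W3 E3 -> sigma_process W4 E4 ->
    P (E1 `&` E2 `&` E3 `&` E4) = (P E1 * P E2 * P E3 * P E4)%E.

(* dY = B(Y) dt + S dW, Y_0 = c: since S is constant, the stochastic integral
   is S W_t. *)
Definition sde_solution k r (B : 'cV[R]_k -> 'cV[R]_k) (S : 'M[R]_(k, r))
    (W : R -> Omega -> 'cV[R]_r) (c : 'cV[R]_k) (Y : R -> Omega -> 'cV[R]_k)
    : Prop :=
  (forall t, 0 <= t -> random_vector (Y t)) /\
  {ae P, forall w, continuous_path (Y ^~ w) /\
     forall t, 0 <= t ->
       Y t w = c + \col_j (\int[lebesgue_measure]_(s in `[0%R, t]) (B (Y s w) j 0))%R
               + S *m W t w}.

Definition bounded_moments k (Y : R -> Omega -> 'cV[R]_k) : Prop :=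
  forall l : R, 0 <= l ->
    (ereal_sup [set 'E_P[(fun w => enorm (Y t w) `^ l)%R] | t in `[0%R, +oo[]
       < +oo)%E.

Definition borel_vec k := g_sigma_algebraType (@open 'cV[R]_k).

(* pi P_t = pi for the transition semigroup P_t(x, A) = P(Phi x t in A), where
   Phi x is the solution started at x. *)
Definition invariant_law k r (B : 'cV[R]_k -> 'cV[R]_k) (S : 'M[R]_(k, r))
    (W : R -> Omega -> 'cV[R]_r) (pi : probability (borel_vec k) R) : Prop :=
  forall Phi : 'cV[R]_k -> R -> Omega -> 'cV[R]_k,
    (forall x, sde_solution B S W x (Phi x)) ->
    forall t, 0 <= t -> forall A : set (borel_vec k), measurable A ->
      (\int[pi]_x P [set w | A (Phi x t w)] = pi A)%E.

(* The outer measure P^* is used because, with paths continuous only almost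
   surely, the event is measurable only up to a null set. *)
Definition cvg_in_probability (Z : R -> Omega -> R) (l : R) : Prop :=
  forall eps : R, 0 < eps ->
    mu_ext P [set w | eps <= `|Z T w - l|] @[T --> +oo%R] --> 0%E.

Definition ergodic k r (B : 'cV[R]_k -> 'cV[R]_k) (S : 'M[R]_(k, r))
    (W : R -> Omega -> 'cV[R]_r) (Y : R -> Omega -> 'cV[R]_k) : Prop :=
  exists pi : probability (borel_vec k) R, invariant_law B S W pi /\
    forall g : borel_vec k -> R, pi.-integrable setT (EFin \o g) ->
      cvg_in_probability
        (fun T w => T^-1 * (\int[lebesgue_measure]_(t in `[0%R, T]) g (Y t w))%R)
        (\int[pi]_x g x)%R.

End Processes.

(* Main.v *)
Require Import Defs.
From HB Require Import structures.
From mathcomp Require Import all_boot all_order all_algebra.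
From mathcomp Require Import all_classical all_reals all_analysis.
From mathcomp Require Import measurable_realfun.
From mathcomp Require Import ring lra.

(* The sparsity of the estimator plays no role under H_1.  As [check n w] lies
   in [Theta], the test statistic is at least [n] times the minimum of the
   contrast over [Theta], whereas the critical value takes finitely many values.
   It is thus enough that this minimum stays bounded away from 0 in probability.
   The increments of the observations are [G] times Gaussian increments of
   variance [h], with [G *m G^T = Sigma true_sem], plus a drift part of mean
   square O(h^2); a law of large numbers then gives
   E |realized_cov - Sigma true_sem| = O(n^(-1/2) + h^(1/2)).  At
   [Sigma true_sem] itself the contrast is at least [U bar] on [Theta], which is
   positive by H_1, and it is Lipschitz in its first argument uniformly over
   [Theta] because [invmx (Sigma theta)] is bounded there by compactness.  *)

Set Implicit Arguments.
Unset Strict Implicit.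
Unset Printing Implicit Defensive.

Import Order.TTheory GRing.Theory Num.Theory.
Import numFieldNormedType.Exports.

Local Open Scope classical_set_scope.
Local Open Scope ring_scope.

(** * Positive definite matrices and the contrast *)

(** The rate has two sources. Centred products of Gaussian increments have variance of order h^2, so
    their normalised sum has mean square O(1/n); this takes fourth moments and the joint
    independence of four increments. The drift parts depend on the noise, so mixed products can only
    be bounded in absolute value: each has mean O(h^(3/2)), and division by h leaves h^(1/2). Both
    estimates pass from mean squares to first moments by weighted forms of 2xy <= t x^2 + y^2 / t.
    Since the sampling step changes with [n], the constants are fixed before [n] and [h]; Markov's
    inequality then concludes. Positivity of the contrast rests on ln (det A) <= tr A - n for
    positive definite A, proved by induction on Schur complements, without eigenvalues. Finally, the
    event of the conclusion must be measurable before its probability can be compared with anything,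
    whence the entrywise calculus for determinants, inverses and supports. *)

Section PositiveDefinite.
Context {R : realType}.

Lemma ln_le_subr1 (x : R) : 0 < x -> ln x <= x - 1.
Proof.
move=> x0; have := expR_ge1Dx (ln x); rewrite lnK ?posrE //; lra.
Qed.

Lemma ln_eq_subr1 (x : R) : 0 < x -> ln x = x - 1 -> x = 1.
Proof.
move=> x0 h; apply/eqP/negPn/negP => x1.
have : ln x != 0 by rewrite ln_eq0.
move=> /expR_gt1Dx; rewrite lnK ?posrE // h; lra.
Qed.

Lemma pdmx_congr m n (A : 'M[R]_m) (L : 'M[R]_(m, n)) :
  (forall x : 'cV[R]_n, x != 0 -> L *m x != 0) -> pdmx A ->
  pdmx (L^T *m A *m L).
Proof.
move=> hL [sA pA]; split; first by rewrite !trmx_mul trmxK sA mulmxA.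
move=> x x0; have := pA _ (hL _ x0).
by rewrite trmx_mul !mulmxA.
Qed.

Lemma unitmx_mul_neq0 n (L : 'M[R]_n) (x : 'cV[R]_n) :
  L \in unitmx -> x != 0 -> L *m x != 0.
Proof.
by move=> uL; apply: contra => /eqP h; rewrite -[x](mulKmx uL) h mulmx0.
Qed.

Definition schur n (A : 'M[R]_(1 + n)) : 'M[R]_n :=
  drsubmx A - (ulsubmx A 0 0)^-1 *: (dlsubmx A *m (dlsubmx A)^T).

(* [elim_mx A] clears the first row and column of a symmetric [A]. *)
Definition elim_mx n (A : 'M[R]_(1 + n)) : 'M[R]_(1 + n) :=
  block_mx 1%:M (- ((ulsubmx A 0 0)^-1 *: (dlsubmx A)^T)) 0 1%:M.

Lemma elim_mx_unit n (A : 'M[R]_(1 + n)) : elim_mx A \in unitmx.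
Proof. by rewrite unitmxE det_ublock !det1 mulr1 unitr1. Qed.

Lemma sym_ursubmx n (A : 'M[R]_(1 + n)) : A^T = A -> ursubmx A = (dlsubmx A)^T.
Proof. by move=> sA; rewrite -{1}sA trmx_dlsub. Qed.

Lemma elim_mxE n (A : 'M[R]_(1 + n)) : A^T = A -> ulsubmx A 0 0 != 0 ->
  (elim_mx A)^T *m A *m elim_mx A =
  block_mx (ulsubmx A 0 0)%:M 0 0 (schur A).
Proof.
move=> sA; rewrite /schur /elim_mx.
set a := ulsubmx A 0 0; set b := dlsubmx A; set C := drsubmx A => a0.
have -> : A = block_mx a%:M b^T b C.
  by rewrite -[LHS]submxK (sym_ursubmx sA) [ulsubmx A]mx11_scalar.
have e0 : (- (a^-1 *: b^T))^T = - (a^-1 *: b).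
  by apply/matrixP => i j; rewrite !mxE.
rewrite tr_block_mx !mulmx_block !trmx1 !trmx0 e0.
rewrite !(mul1mx, mulmx1, mul0mx, mulmx0, addr0, add0r).
have e1 : a%:M *m - (a^-1 *: b^T) = - b^T.
  by rewrite mulmxN -scalemxAr mul_scalar_mx scalerA mulVf // scale1r.
have e2 : - (a^-1 *: b) *m a%:M = - b.
  by rewrite mulNmx -scalemxAl mul_mx_scalar scalerA mulVf // scale1r.
by rewrite e1 e2 !addNr mul0mx add0r mulNmx -scalemxAl addrC.
Qed.

Lemma pdmx_block_gt0 n (A : 'M[R]_(1 + n)) : pdmx A -> 0 < ulsubmx A 0 0.
Proof.
move=> [sA pA]; have := pA (delta_mx 0 0); rewrite trmx_delta -rowE.
rewrite mxE (bigD1 0) //= big1 ?addr0; last first.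
  by move=> i i0; rewrite [X in _ * X]mxE (negPf i0) mulr0.
rewrite [X in _ * X]mxE !eqxx mulr1 !mxE => h.
have -> : lshift n 0 = 0 :> 'I_(1 + n) by apply/val_inj.
apply: h; apply/eqP => /matrixP/(_ 0 0); rewrite !mxE !eqxx => /eqP.
by rewrite oner_eq0.
Qed.

(** The Schur complement is the lower right block of the congruent matrix in [elim_mxE], extracted
    by the injection [col_mx 0 1%:M]. As a congruence by an injective matrix it inherits positive
    definiteness. *)
Lemma schur_congr n (A : 'M[R]_(1 + n)) : pdmx A -> schur A =
  (elim_mx A *m col_mx 0 1%:M)^T *m A *m (elim_mx A *m col_mx 0 1%:M).
Proof.
move=> pA; have [sA _] := pA.
rewrite trmx_mul -!mulmxA [elim_mx A]lock !mulmxA -lock.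
rewrite -2!(mulmxA (col_mx _ _)^T) elim_mxE //; last first.
  by rewrite gt_eqF // pdmx_block_gt0.
rewrite tr_col_mx mul_row_block trmx1 trmx0 mul_row_col.
by rewrite !(mul1mx, mulmx1, mul0mx, mulmx0, addr0, add0r).
Qed.

Lemma pdmx_schur n (A : 'M[R]_(1 + n)) : pdmx A -> pdmx (schur A).
Proof.
move=> pA; rewrite schur_congr //; apply: pdmx_congr => // x x0.
rewrite -mulmxA unitmx_mul_neq0 ?elim_mx_unit //.
rewrite mul_col_mx mul0mx mul1mx; apply: contra x0 => /eqP h.
by rewrite -[x](col_mxKd (0 : 'M[R]_(1, _))) h linear0.
Qed.

Lemma det_schur n (A : 'M[R]_(1 + n)) : pdmx A ->
  \det A = ulsubmx A 0 0 * \det (schur A).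
Proof.
move=> pA; have [sA _] := pA; have a0 := pdmx_block_gt0 pA.
have := congr1 determinant (elim_mxE sA (lt0r_neq0 a0)).
rewrite !det_mulmx det_tr [\det (elim_mx A)]det_ublock !det1 !mul1r !mulr1.
by rewrite det_ublock det_scalar1.
Qed.

Lemma pdmx_det_gt0 n (A : 'M[R]_n) : pdmx A -> 0 < \det A.
Proof.
elim: n A => [|n IH] A pA; first by rewrite det_mx00.
by rewrite (@det_schur n A pA) mulr_gt0 ?pdmx_block_gt0 // IH //; exact: pdmx_schur.
Qed.

Lemma pdmx_unit n (A : 'M[R]_n) : pdmx A -> A \in unitmx.
Proof. by move=> /pdmx_det_gt0 h; rewrite unitmxE unitfE gt_eqF. Qed.

Lemma mxtrace_schur n (A : 'M[R]_(1 + n)) :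
  \tr A = ulsubmx A 0 0 + \tr (schur A) +
          (ulsubmx A 0 0)^-1 * \sum_i (dlsubmx A) i 0 ^+ 2.
Proof.
rewrite -{1}(submxK A) mxtrace_block -addrA; congr (_ + _); first by rewrite trace_mx11.
rewrite /schur linearB linearZ /= -[LHS]addr0 -addrA; congr (_ + _).
rewrite [\tr (_ *m _)](_ : _ = \sum_i dlsubmx A i 0 ^+ 2) ?addNr //.
by apply: eq_bigr => i _; rewrite mxE big_ord1 [X in _ * X]mxE expr2.
Qed.

(* With [a] the corner and [b] the rest of the first column,
   [\tr A - n - ln (\det A)] is [a - 1 - ln a], plus the same expression for
   the Schur complement, plus [|b|^2 / a]. *)
Lemma ln_det_le n (A : 'M[R]_n) : pdmx A ->
  ln (\det A) <= \tr A - n%:R /\ (ln (\det A) = \tr A - n%:R -> A = 1%:M).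
Proof.
elim: n A => [|n IH] A pA.
  split; last by move=> _; apply/matrixP => -[].
  by rewrite det_mx00 ln1 /mxtrace big_ord0 subr0.
have a0 : 0 < ulsubmx (A : 'M[R]_(1 + n)) 0 0 by exact: pdmx_block_gt0.
have [hle heq] := IH _ (pdmx_schur (A := A) pA).
have d0 := pdmx_det_gt0 (pdmx_schur (A := A) pA).
rewrite (@det_schur n A pA) lnM ?posrE // (@mxtrace_schur n A).
set a := ulsubmx _ 0 0 in a0 *; set b := dlsubmx _.
have ha := ln_le_subr1 a0.
have s0 : 0 <= \sum_i b i 0 ^+ 2 by apply: sumr_ge0 => i _; exact: sqr_ge0.
have hb : 0 <= a^-1 * \sum_i b i 0 ^+ 2 by rewrite mulr_ge0 // invr_ge0 ltW.
split; first by rewrite -natr1; lra.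
rewrite -natr1 => hE.
(* The gap [a - 1 - ln a], that of the Schur complement and [|b|^2 / a] are nonnegative with sum 0,
   so each of them vanishes. *)
have e1 : a = 1 by apply: ln_eq_subr1 => //; lra.
have e2 : schur (A : 'M[R]_(1 + n)) = 1%:M by apply: heq; lra.
have e3 : \sum_i b i 0 ^+ 2 = 0 by move: hb hE ha hle; rewrite e1 ln1 invr1 mul1r; lra.
have b0 : b = 0.
  apply/matrixP => i j; rewrite [RHS]mxE (ord1 j); apply/eqP.
  have /eqP := e3; rewrite psumr_eq0; last by move=> k _; exact: sqr_ge0.
  by move=> /allP/(_ i (mem_index_enum i)) /=; rewrite sqrf_eq0.
have [sA _] := pA.
rewrite -[A](@submxK _ 1 n 1 n) (sym_ursubmx (A := A) sA) -/b b0 trmx0.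
rewrite [ulsubmx _]mx11_scalar -/a e1.
move: e2; rewrite /schur -/b b0 mul0mx scaler0 subr0 => ->.
by rewrite -scalar_mx_block.
Qed.

(** A Cholesky reduction by induction: [elim_mx] clears the first row and column, the corner is
    scaled by [1 / sqrt a], and the Schur complement is reduced recursively. *)
Lemma pdmx_congr1 n (A : 'M[R]_n) : pdmx A ->
  exists2 L, L \in unitmx & L^T *m A *m L = 1%:M.
Proof.
elim: n A => [|n IH] A pA.
  by exists 1%:M; [exact: unitmx1|apply/matrixP => -[]].
have a0 : 0 < ulsubmx (A : 'M[R]_(1 + n)) 0 0 by exact: pdmx_block_gt0.
have [L uL hL] := IH _ (pdmx_schur (A := A) pA).
set a := ulsubmx _ 0 0 in a0.
pose D : 'M[R]_(1 + n) := block_mx (Num.sqrt a)^-1%:M 0 0 L.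
have uD : D \in unitmx.
  rewrite unitmxE det_ublock det_scalar1 unitrM unitrV -unitmxE uL andbT.
  by rewrite unitfE gt_eqF // sqrtr_gt0.
exists (elim_mx (A : 'M[R]_(1 + n)) *m D).
  by rewrite unitmx_mul elim_mx_unit.
have eD : D^T *m block_mx a%:M 0 0 (schur (A : 'M[R]_(1 + n))) *m D = 1%:M.
  rewrite /D tr_block_mx !mulmx_block !trmx0 tr_scalar_mx.
  rewrite !(mul0mx, mulmx0, addr0, add0r) hL -!scalar_mxM.
  rewrite mulrC mulrA -expr2 exprVn sqr_sqrtr ?ltW // mulVf ?gt_eqF //.
  by rewrite -scalar_mx_block.
have [sA _] := pA.
rewrite -eD -(elim_mxE (A := A) sA (lt0r_neq0 a0)).
by rewrite trmx_mul !mulmxA.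
Qed.

(** Take [L] with [L^T S L = 1]. Then [invmx S = L L^T], and with [A = L^T Q L] the contrast equals
    [tr A - n - ln (det A)], which [ln_det_le] shows nonnegative. Equality would force
    [A = 1 = L^T S L], that is [Q = S]. *)
Lemma contrast_gt0 n (Q S : 'M[R]_n) : pdmx Q -> pdmx S -> Q <> S ->
  0 < contrast Q S.
Proof.
move=> pQ pS neq; have [L uL hL] := pdmx_congr1 pS.
have pLQ : pdmx (L^T *m Q *m L).
  by apply: pdmx_congr => // x; exact: unitmx_mul_neq0.
have [hle heq] := ln_det_le pLQ.
have dL : \det L ^+ 2 * \det S = 1.
  by rewrite -(det1 R n) -hL !det_mulmx det_tr; ring.
have eS : invmx S = L *m L^T.
  have uS := pdmx_unit pS; have uLt : L^T \in unitmx by rewrite unitmx_tr.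
  have h : S *m (L *m L^T) = 1%:M.
    rewrite -[LHS](mulKmx uLt); have -> : L^T *m (S *m (L *m L^T)) = L^T.
      by rewrite !mulmxA hL mul1mx.
    by rewrite mulVmx.
  by rewrite -[RHS](mulKmx uS) h mulmx1.
have dQ := pdmx_det_gt0 pQ; have dS := pdmx_det_gt0 pS.
have dL0 : 0 < \det L ^+ 2.
  by rewrite exprn_even_gt0 //= -unitfE -unitmxE.
have e1 : ln (\det (L^T *m Q *m L)) = ln (\det Q) - ln (\det S).
  rewrite !det_mulmx det_tr mulrAC -expr2 lnM ?posrE //.
  have := congr1 (@ln R) dL; rewrite lnM ?posrE // ln1; lra.
have e2 : \tr (invmx S *m Q) = \tr (L^T *m Q *m L).
  by rewrite eS -(mulmxA L) [LHS]mxtrace_mulC.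
rewrite /contrast e2; rewrite e1 in hle heq.
rewrite lt_neqAle; apply/andP; split; last by lra.
apply/eqP => h; apply: neq; have uLt : L^T \in unitmx by rewrite unitmx_tr.
apply: (can_inj (mulKmx uLt)); apply: (can_inj (mulmxK uL)).
by rewrite hL; apply: heq; lra.
Qed.

End PositiveDefinite.

(** * Decomposition of [Sigma] along the four latent processes *)

Section SigmaDecomposition.
Context {R : realType} {p1 p2 k1 k2 : nat}.
Implicit Type s : sem R p1 p2 k1 k2.

(** Once eta is eliminated, the observation is linear in xi, delta, epsilon and zeta; this matrix
    and the next three are its coefficients. *)
Definition load_xi s : 'M[R]_(p1 + p2, k1) :=
  col_mx (Lx1 s) (Lx2 s *m invmx (Psi s) *m Gam s).
Definition load_delta : 'M[R]_(p1 + p2, p1) := col_mx 1%:M 0.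
Definition load_eps : 'M[R]_(p1 + p2, p2) := col_mx 0 1%:M.
Definition load_zeta s : 'M[R]_(p1 + p2, k2) :=
  col_mx 0 (Lx2 s *m invmx (Psi s)).

Lemma mul_col_mx_tr m1 m2 n (A : 'M[R]_(m1, n)) (B : 'M[R]_(m2, n))
    (S : 'M[R]_n) :
  col_mx A B *m S *m (col_mx A B)^T =
  block_mx (A *m S *m A^T) (A *m S *m B^T) (B *m S *m A^T) (B *m S *m B^T).
Proof. by rewrite tr_col_mx mul_col_mx mul_col_row. Qed.

(** This is the covariance of a linear image of four uncorrelated blocks. Symmetry of [Sxi] serves
    to match the lower left block, which [Sigma] defines as a transpose. *)
Lemma SigmaE s : (Sxi s)^T = Sxi s -> Sigma s =
  load_xi s *m Sxi s *m (load_xi s)^T +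
  load_delta *m Sdelta s *m load_delta^T +
  (load_eps *m Seps s *m load_eps^T +
  load_zeta s *m Szeta s *m (load_zeta s)^T).
Proof.
move=> sxi; rewrite /load_xi /load_delta /load_eps /load_zeta.
rewrite !mul_col_mx_tr !trmx1 !trmx0 !(mul0mx, mulmx0, mulmx1, mul1mx).
rewrite !add_block_mx !(addr0, add0r) /Sigma.
rewrite !trmx_mul !trmxK sxi !mulmxDr !mulmxDl !mulmxA -addrA.
by congr (block_mx _ _ _ (_ + _)); exact: addrC.
Qed.

Lemma psdmx_congr m n (A : 'M[R]_n) (C : 'M[R]_(m, n)) (x : 'cV[R]_m) :
  psdmx A -> 0 <= (x^T *m (C *m A *m C^T) *m x) 0 0.
Proof.
move=> [_ /(_ (C^T *m x))]; by rewrite trmx_mul trmxK !mulmxA.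
Qed.

Lemma pdmx_psdmx n (A : 'M[R]_n) : pdmx A -> psdmx A.
Proof.
move=> [sA pA]; split=> // x; have [->|x0] := eqVneq x 0; last exact/ltW/pA.
by rewrite mulmx0 mxE.
Qed.

Lemma pdmx_Sigma s : sem_admissible s -> pdmx (Sigma s).
Proof.
move=> [_ _ [pxi pzeta] [pdelta peps]].
have [[sxi _] [szeta _]] := (pxi, pzeta).
have [[sdelta hdelta] [seps heps]] := (pdelta, peps).
rewrite SigmaE //; split.
  by rewrite !linearD /= !trmx_mul !trmxK sxi szeta sdelta seps !mulmxA.
move=> x x0; rewrite !mulmxDr !mulmxDl mxE [X in X + _]mxE [X in _ + X]mxE.
have [h1 h2] := (psdmx_congr (load_xi s) x pxi, psdmx_congr (load_zeta s) x pzeta).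
have h3 := psdmx_congr load_delta x (pdmx_psdmx pdelta).
have h4 := psdmx_congr load_eps x (pdmx_psdmx peps).
(* All four quadratic forms are nonnegative. [load_delta] reads only the upper block of [x] and
   [load_eps] only the lower one; whichever block is nonzero makes its form strictly positive. *)
have [u0|u0] := eqVneq (usubmx x) 0; last first.
  suff : 0 < (x^T *m (load_delta *m Sdelta s *m load_delta^T) *m x) 0 0 by lra.
  have := hdelta _ u0.
  rewrite -{3 4}(vsubmxK x) /load_delta !tr_col_mx trmx1 trmx0 !mulmxA.
  by rewrite mul_row_col -!mulmxA mul_row_col !mul0mx mul1mx mulmx0 mulmx1 !addr0 !mulmxA.
have d0 : dsubmx x != 0.
  by apply: contra x0 => /eqP d0; rewrite -(vsubmxK x) u0 d0 col_mx0.
suff : 0 < (x^T *m (load_eps *m Seps s *m load_eps^T) *m x) 0 0 by lra.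
have := heps _ d0.
rewrite -{3 4}(vsubmxK x) /load_eps !tr_col_mx trmx1 trmx0 !mulmxA.
by rewrite mul_row_col -!mulmxA mul_row_col !mul0mx mul1mx mulmx0 mulmx1 !add0r !mulmxA.
Qed.

End SigmaDecomposition.

(** * Entrywise measurability and continuity *)

(* An algebra of functions closed under sums and products is all that is used of
   measurable functions and of functions continuous at a point. *)
Section FunctionAlgebra.
Context {R : realType} {T : Type} (K : (T -> R) -> Prop).

Record fun_algebra : Prop := FunAlgebra {
  fun_algebra_cst : forall c, K (fun=> c);
  fun_algebraD : forall f g, K f -> K g -> K (fun t => f t + g t);
  fun_algebraM : forall f g, K f -> K g -> K (fun t => f t * g t) }.

Hypothesis aK : fun_algebra.

(** When [K] is measurability this is convertible to [random_vector], so the closure lemmas apply to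
    random matrices as they stand. *)
Definition entrywise m n (A : T -> 'M[R]_(m, n)) : Prop :=
  forall i j, K (fun t => A t i j).

Lemma fun_algebra_sum I (r : seq I) (P : pred I) (F : I -> T -> R) :
  (forall i, K (F i)) -> K (fun t => \sum_(i <- r | P i) F i t).
Proof.
move=> KF; elim: r => [|i r IH].
  by under eq_fun do rewrite big_nil; exact: fun_algebra_cst.
under eq_fun do rewrite big_cons.
by case: (P i) => //; exact: fun_algebraD.
Qed.

Lemma fun_algebra_prod I (r : seq I) (P : pred I) (F : I -> T -> R) :
  (forall i, K (F i)) -> K (fun t => \prod_(i <- r | P i) F i t).
Proof.
move=> KF; elim: r => [|i r IH].
  by under eq_fun do rewrite big_nil; exact: fun_algebra_cst.
under eq_fun do rewrite big_cons.
by case: (P i) => //; exact: fun_algebraM.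
Qed.

Lemma fun_algebraZ c f : K f -> K (fun t => c * f t).
Proof. by move=> Kf; apply: fun_algebraM => //; exact: fun_algebra_cst. Qed.

Lemma fun_algebraN f : K f -> K (fun t => - f t).
Proof. by move=> Kf; under eq_fun do rewrite -mulN1r; exact: fun_algebraZ. Qed.

Lemma fun_algebraB f g : K f -> K g -> K (fun t => f t - g t).
Proof. by move=> Kf Kg; apply: fun_algebraD => //; exact: fun_algebraN. Qed.

Lemma fun_algebraX f n : K f -> K (fun t => f t ^+ n).
Proof.
move=> Kf; elim: n => [|n IH]; first exact: fun_algebra_cst.
by under eq_fun do rewrite exprS; exact: fun_algebraM.
Qed.

Lemma entrywise_cst m n (A : 'M[R]_(m, n)) : entrywise (fun=> A).
Proof. by move=> i j; exact: fun_algebra_cst. Qed.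

Lemma entrywise_add m n (A B : T -> 'M[R]_(m, n)) :
  entrywise A -> entrywise B -> entrywise (fun t => A t + B t).
Proof.
by move=> KA KB i j; under eq_fun do rewrite mxE; exact: fun_algebraD.
Qed.

Lemma entrywise_scale m n c (A : T -> 'M[R]_(m, n)) :
  entrywise A -> entrywise (fun t => c *: A t).
Proof. by move=> KA i j; under eq_fun do rewrite mxE; exact: fun_algebraZ. Qed.

Lemma entrywise_sub m n (A B : T -> 'M[R]_(m, n)) :
  entrywise A -> entrywise B -> entrywise (fun t => A t - B t).
Proof.
move=> KA KB; apply: entrywise_add => //.
by under eq_fun do rewrite -scaleN1r; exact: entrywise_scale.
Qed.

Lemma entrywise_mul m n p (A : T -> 'M[R]_(m, n)) (B : T -> 'M[R]_(n, p)) :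
  entrywise A -> entrywise B -> entrywise (fun t => A t *m B t).
Proof.
move=> KA KB i j; under eq_fun do rewrite mxE.
by apply: fun_algebra_sum => k; exact: fun_algebraM.
Qed.

Lemma entrywise_tr m n (A : T -> 'M[R]_(m, n)) :
  entrywise A -> entrywise (fun t => (A t)^T).
Proof. by move=> KA i j; under eq_fun do rewrite mxE. Qed.

Lemma entrywise_sum I (r : seq I) (P : pred I) m n (A : I -> T -> 'M[R]_(m, n)) :
  (forall i, entrywise (A i)) ->
  entrywise (fun t => \sum_(i <- r | P i) A i t).
Proof.
move=> KA i j; under eq_fun do rewrite summxE.
by apply: fun_algebra_sum => k; exact: KA.
Qed.

Lemma entrywise_block m1 m2 n1 n2 (A : T -> 'M[R]_(m1, n1))
    (B : T -> 'M[R]_(m1, n2)) (C : T -> 'M[R]_(m2, n1)) (D : T -> 'M[R]_(m2, n2)) :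
  entrywise A -> entrywise B -> entrywise C -> entrywise D ->
  entrywise (fun t => block_mx (A t) (B t) (C t) (D t)).
Proof.
move=> KA KB KC KD i j.
case: (split_ordP i) => i' ->; case: (split_ordP j) => j' ->.
- by under eq_fun do rewrite block_mxEul.
- by under eq_fun do rewrite block_mxEur.
- by under eq_fun do rewrite block_mxEdl.
- by under eq_fun do rewrite block_mxEdr.
Qed.

Lemma entrywise_col m1 m2 n (A : T -> 'M[R]_(m1, n)) (B : T -> 'M[R]_(m2, n)) :
  entrywise A -> entrywise B -> entrywise (fun t => col_mx (A t) (B t)).
Proof.
move=> KA KB i j; case: (split_ordP i) => i' ->.
- by under eq_fun do rewrite col_mxEu.
- by under eq_fun do rewrite col_mxEd.
Qed.

Lemma entrywise_det n (A : T -> 'M[R]_n) : entrywise A -> K (fun t => \det (A t)).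
Proof.
move=> KA; apply: fun_algebra_sum => s; apply: fun_algebraZ.
by apply: fun_algebra_prod => i; exact: KA.
Qed.

Lemma entrywise_adj n (A : T -> 'M[R]_n) :
  entrywise A -> entrywise (fun t => \adj (A t)).
Proof.
move=> KA i j; under eq_fun do rewrite mxE /cofactor.
apply: fun_algebraZ; apply: entrywise_det => k l.
by under eq_fun do rewrite !mxE; exact: KA.
Qed.

Lemma entrywise_trace n (A : T -> 'M[R]_n) :
  entrywise A -> K (fun t => \tr (A t)).
Proof. by move=> KA; apply: fun_algebra_sum => i; exact: KA. Qed.

(** Inversion is not an algebra operation, so the inverse of [Psi] enters as a hypothesis. It is
    discharged separately, everywhere for measurability but only at invertible points for
    continuity. *)
Lemma entrywise_Sigma p1 p2 k1 k2 (s : T -> sem R p1 p2 k1 k2) :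
  entrywise (fun t => Lx1 (s t)) -> entrywise (fun t => Lx2 (s t)) ->
  entrywise (fun t => Gam (s t)) -> entrywise (fun t => invmx (Psi (s t))) ->
  entrywise (fun t => Sxi (s t)) -> entrywise (fun t => Sdelta (s t)) ->
  entrywise (fun t => Seps (s t)) -> entrywise (fun t => Szeta (s t)) ->
  entrywise (fun t => Sigma (s t)).
Proof.
move=> K1 K2 K3 K4 K5 K6 K7 K8; rewrite /Sigma.
have K12 : entrywise (fun t => Lx1 (s t) *m Sxi (s t) *m (Gam (s t))^T *m
    (invmx (Psi (s t)))^T *m (Lx2 (s t))^T).
  by do ?[apply: entrywise_mul | apply: entrywise_tr].
apply: entrywise_block => //; last 2 first.
- exact: entrywise_tr.
- apply: entrywise_add => //.
  by do ?[apply: entrywise_mul | apply: entrywise_tr | apply: entrywise_add].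
apply: entrywise_add => //.
by do ?[apply: entrywise_mul | apply: entrywise_tr].
Qed.

End FunctionAlgebra.

(** * Measurability of inverses, contrasts and supports *)

Section MeasurableEntries.
Context {d : measure_display} {Omega : measurableType d} {R : realType}.

Lemma measurable_fun_algebra :
  fun_algebra (fun f : Omega -> R => measurable_fun setT f).
Proof.
split=> [c|f g mf mg|f g mf mg]; first exact: measurable_cst.
  exact: measurable_funD.
exact: measurable_funM.
Qed.

Lemma measurable_inv_real : measurable_fun setT (fun x : R => x^-1).
Proof.
(* Squaring makes the base nonnegative, where the real power -1 is the inverse; at 0 both sides are
   0 by convention. *)
have -> : (fun x : R => x^-1) = (fun x => x * (x ^+ 2) `^ (-1)).
  apply/funext => x; rewrite powR_inv1 ?sqr_ge0 //.
  have [->|x0] := eqVneq x 0; first by rewrite invr0 mul0r.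
  by rewrite expr2 invfM mulrA divff // mul1r.
apply: measurable_funM => //.
by apply: (measurableT_comp (measurable_powR _)); exact: measurable_funX.
Qed.

Lemma measurable_unitmx n (A : Omega -> 'M[R]_n) :
  random_vector A -> measurable_fun setT (fun w => A w \in unitmx).
Proof.
move=> mA; have mdet := entrywise_det measurable_fun_algebra mA.
have -> : (fun w => A w \in unitmx) = (fun w => ~~ (\det (A w) == cst 0 w)).
  by apply/funext => w; rewrite unitmxE unitfE.
apply: measurable_neg; exact: measurable_fun_eqr.
Qed.

Lemma random_vector_invmx n (A : Omega -> 'M[R]_n) :
  random_vector A -> random_vector (fun w => invmx (A w)).
Proof.
move=> mA i j.
(* [invmx] returns its argument on a singular matrix, hence the second branch. *)
have -> : (fun w => invmx (A w) i j) = (fun w =>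
    if A w \in unitmx then (\det (A w))^-1 * (\adj (A w)) i j else A w i j).
  by apply/funext => w; rewrite /invmx; case: ifP => //; rewrite mxE.
apply: measurable_fun_ifT; [exact: measurable_unitmx| |exact: mA].
apply: measurable_funM; last exact: (entrywise_adj measurable_fun_algebra).
apply: (measurableT_comp measurable_inv_real).
exact: (entrywise_det measurable_fun_algebra).
Qed.

Lemma measurable_empirical_contrast p (Q S : Omega -> 'M[R]_p) :
  random_vector Q -> random_vector S ->
  measurable_fun setT (fun w => empirical_contrast (Q w) (S w)).
Proof.
move=> mQ mS; have aK := measurable_fun_algebra.
rewrite /empirical_contrast /contrast /enorm.
apply: measurable_fun_ifT; first exact: measurable_unitmx.
  apply: (fun_algebraB aK); last exact: measurable_cst.
  apply: (fun_algebraD aK).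
    by apply: (fun_algebraB aK); apply: (measurableT_comp (@measurable_ln R));
      exact: (entrywise_det aK).
  apply: (entrywise_trace aK); apply: (entrywise_mul aK) => //.
  exact: random_vector_invmx.
apply: (fun_algebraX aK).
apply: (measurableT_comp (continuous_measurable_fun (@sqrt_continuous R))).
apply: (fun_algebra_sum aK) => i; apply: (fun_algebraX aK).
under eq_fun do rewrite !mxE; apply: (fun_algebraB aK); [exact: mQ|exact: mS].
Qed.

Lemma measurable_active q (theta : Omega -> 'rV[R]_q) (g : nat -> R) :
  random_vector theta -> measurable_fun setT (fun w => g #|active (theta w)|).
Proof.
move=> mt; have aK := measurable_fun_algebra.
(* The product over [j] is the indicator of the event that the support equals [A]; only finitely
   many supports [A] are possible. *)
have -> : (fun w => g #|active (theta w)|) = (fun w => \sum_(A : {set 'I_q})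
    g #|A| * \prod_j (if theta w 0 j == cst 0 w then (j \notin A)%:R
                      else (j \in A)%:R)).
  apply/funext => w; rewrite (bigD1 (active (theta w))) //= [X in _ + X]big1.
    rewrite addr0 big1 ?mulr1 // => j _; rewrite inE /cst.
    by case: (theta w 0 j == 0).
  move=> A neq; have [j hj] : exists j, (j \in A) != (j \in active (theta w)).
    apply/existsP; rewrite -negb_forall; apply: contra neq => /forallP h.
    by apply/eqP/setP => j; exact/eqP/h.
  rewrite (bigD1 j) //= /cst; move: hj; rewrite inE.
  by case: (j \in A); case: (theta w 0 j == 0) => //= _; rewrite mul0r mulr0.
apply: (fun_algebra_sum aK) => A; apply: (fun_algebraZ aK).
apply: (fun_algebra_prod aK) => j; apply: measurable_fun_ifT => //.
by apply: measurable_fun_eqr => //; exact: mt.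
Qed.

Lemma random_vector_sem_at p1 p2 k1 k2 q (M : sem_template R p1 p2 k1 k2 q)
    (theta : Omega -> 'rV[R]_q) : random_vector theta ->
  random_vector (fun w => Sigma (sem_at M (theta w))).
Proof.
move=> mt; have aK := measurable_fun_algebra.
have mm m n (A : 'M[(R + 'I_q)%type]_(m, n)) :
    random_vector (fun w => map_mx (entry_at (theta w)) A).
  move=> i j; under eq_fun do rewrite mxE.
  by case: (A i j) => [c|k] /=; [exact: measurable_cst|exact: mt].
by apply: (entrywise_Sigma aK); try (exact: mm); exact/random_vector_invmx/mm.
Qed.

End MeasurableEntries.

(** * Continuity, compactness and stability of the contrast *)

Section ContinuousEntries.
Context {R : realType}.

Lemma continuous_fun_algebra (T : topologicalType) (t : T) :
  fun_algebra (fun f : T -> R => continuous_at t f).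
Proof.
split=> [c|f g mf mg|f g mf mg]; first exact: cvg_cst.
  exact: cvgD.
exact: cvgM.
Qed.

(** The determinant is continuous and nonzero at [t], so the adjugate formula for the inverse holds
    on a whole neighbourhood, and its right-hand side is continuous at [t]. *)
Lemma continuous_invmx (T : topologicalType) (t : T) n (A : T -> 'M[R]_n) :
  entrywise (fun f => continuous_at t f) A -> A t \in unitmx ->
  entrywise (fun f => continuous_at t f) (fun s => invmx (A s)).
Proof.
move=> cA uA i j; have aK := continuous_fun_algebra t.
have cdet := entrywise_det aK cA.
have d0 : \det (A t) != 0 by rewrite -unitfE -unitmxE.
have invE s : A s \in unitmx ->
    invmx (A s) i j = (\det (A s))^-1 * (\adj (A s)) i j.
  by move=> us; rewrite /invmx us mxE.
rewrite /continuous_at invE //.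
have : (fun s => (\det (A s))^-1 * (\adj (A s)) i j) @ t -->
    (\det (A t))^-1 * (\adj (A t)) i j.
  by apply: cvgM; [exact: cvgV|exact: (entrywise_adj aK cA)].
apply: cvg_trans.
apply: near_eq_cvg; apply: filterS (cvgr_neq0 _ cdet d0) => s ds.
by rewrite invE // unitmxE unitfE.
Qed.

Lemma compact_continuous_bounded (T : topologicalType) (A : set T) (f : T -> R) :
  compact A -> (forall t, A t -> continuous_at t f) ->
  exists B, forall t, A t -> `|f t| <= B.
Proof.
move=> cA cf; have : compact (f @` A).
  apply: continuous_compact => //; apply: continuous_in_subspaceT => t.
  by rewrite inE; exact: cf.
move=> /compact_bounded[B [_ hB]]; exists (B + 1) => t At.
by apply: (hB (B + 1)); [rewrite ltrDl|exists t].
Qed.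

Lemma invmx_Sigma_bounded p1 p2 k1 k2 q (M : sem_template R p1 p2 k1 k2 q)
    (Theta : set 'rV[R]_q) : compact Theta ->
  (forall theta, Theta theta -> sem_admissible (sem_at M theta)) ->
  exists B, forall theta i j, Theta theta ->
    `|invmx (Sigma (sem_at M theta)) i j| <= B.
Proof.
move=> cT adm.
have bnd i j : exists B, forall theta, Theta theta ->
    `|invmx (Sigma (sem_at M theta)) i j| <= B.
  apply: compact_continuous_bounded => // theta Ttheta.
  have aK := continuous_fun_algebra theta.
  have cc m n (A : 'M[(R + 'I_q)%type]_(m, n)) :
      entrywise (fun f => continuous_at theta f)
        (fun w => map_mx (entry_at w) A).
    move=> k l; under eq_fun do rewrite mxE.
    by case: (A k l) => [c|e]; [exact: (fun_algebra_cst aK)|exact: coord_continuous].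
  apply: continuous_invmx; last exact/pdmx_unit/pdmx_Sigma/adm.
  apply: (entrywise_Sigma aK); try exact: cc.
  by apply: continuous_invmx; [exact: cc|have [_ []] := adm _ Ttheta].
have [B hB] := choice (fun ij : 'I_(p1 + p2) * 'I_(p1 + p2) => bnd ij.1 ij.2).
exists (\sum_ij `|B ij|) => theta i j Ttheta.
rewrite (bigD1 (i, j)) //=; apply: (le_trans (hB (i, j) _ Ttheta)).
by rewrite (le_trans (ler_norm _)) // lerDl sumr_ge0.
Qed.

(** Replacing [S0] by [Q] changes the contrast by a difference of log-determinants that does not
    involve [S t], and by the trace of [invmx (S t) *m (Q - S0)], which [B] controls uniformly in
    [t]. Each change is allowed [c / 4]. *)
Lemma contrast_near_lower_bound p (T : Type) (A : set T) (S : T -> 'M[R]_p)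
    (S0 : 'M[R]_p) (B c : R) : 0 < \det S0 -> 0 < c ->
  (forall t i j, A t -> `|invmx (S t) i j| <= B) ->
  (forall t, A t -> c <= contrast S0 (S t)) ->
  exists2 e, 0 < e & forall Q : 'M[R]_p,
    (forall i j, `|Q i j - S0 i j| < e) -> Q \in unitmx /\
    forall t, A t -> c / 2 <= contrast Q (S t).
Proof.
move=> dS0 c0 hB hc; have aK := continuous_fun_algebra S0.
have cdet : continuous_at S0 (fun Q : 'M[R]_p => \det Q).
  apply: (entrywise_det aK) => i j; exact: coord_continuous.
have cln : continuous_at S0 (fun Q : 'M[R]_p => ln (\det Q)).
  exact: (continuous_comp cdet (continuous_ln dS0)).
have c4 : 0 < c / 4 by rewrite divr_gt0.
have /nbhs_ballP[e1 /= e10 he1] : \forall Q \near S0,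
    0 < \det Q /\ `|ln (\det S0) - ln (\det Q)| < c / 4.
  near=> Q; split; near: Q.
    exact: (cvgr_gt _ cdet).
  by move/cvgrPdist_lt : cln => /(_ _ c4).
(* The trace is a sum of [p ^ 2] products bounded by [|B|] times the distance; the added 1 keeps the
   divisor positive. *)
pose B' := `|B| * p%:R ^+ 2 + 1.
have B'0 : 0 < B' by rewrite ltr_wpDl // mulr_ge0 // exprn_ge0.
exists (Num.min e1 (c / 4 / B')); first by rewrite lt_min e10 divr_gt0.
move=> Q hQ; have [dQ lnQ] : 0 < \det Q /\ `|ln (\det S0) - ln (\det Q)| < c / 4.
  apply: he1; split=> // i j; rewrite /ball /= distrC.
  by rewrite (lt_le_trans (hQ i j)) // ge_min lexx.
split; first by rewrite unitmxE unitfE gt_eqF.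
move=> t At; have := hc _ At; rewrite /contrast.
have -> : invmx (S t) *m Q = invmx (S t) *m S0 + invmx (S t) *m (Q - S0).
  by rewrite -mulmxDr addrC subrK.
rewrite linearD /=.
suff : `|\tr (invmx (S t) *m (Q - S0))| <= c / 4.
  move: lnQ; rewrite ltr_norml ler_norml => /andP[? ?] /andP[? ?]; lra.
apply: (@le_trans _ _ (\sum_(i < p) \sum_(j < p) `|B| * (c / 4 / B'))).
  apply: (le_trans (ler_norm_sum _ _ _)); apply: ler_sum => i _.
  rewrite mxE; apply: (le_trans (ler_norm_sum _ _ _)); apply: ler_sum => j _.
  rewrite normrM; apply: ler_pM => //.
    by rewrite (le_trans (hB _ _ _ At)) // ler_norm.
  by rewrite !mxE ltW // (lt_le_trans (hQ j i)) // ge_min lexx orbT.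
rewrite !sumr_const card_ord -mulrnA -[X in X <= _]mulr_natr natrM.
rewrite [X in _ <= X](_ : _ = c / 4 / B' * B'); last by rewrite divfK ?gt_eqF.
rewrite mulrAC mulrC; apply: ler_wpM2l; first by rewrite divr_ge0 // ltW.
by rewrite /B' expr2 lerDl.
Unshelve. all: by end_near. Qed.

End ContinuousEntries.

(** * Gaussian increments *)

Section NormalMoments.
Context {R : realType}.
Local Notation mu := (@lebesgue_measure R).

Lemma normal_pdf0E (s : R) : s != 0 ->
  normal_pdf 0 s = (fun x => normal_peak s * expR (- (s ^+ 2 *+ 2)^-1 * x ^+ 2)).
Proof.
move=> s0; apply/funext => x; rewrite normal_pdfE // /normal_fun subr0.
by rewrite !mulNr [x ^+ 2 / _]mulrC.
Qed.

(** Integration by parts in differential form: integrating it over a segment links the moments of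
    order [k] and [k + 2]. *)
Lemma is_derive_exp_normal_pdf (s x : R) k : s != 0 ->
  is_derive x 1 (fun y => y ^+ k.+1 * normal_pdf 0 s y)
    (k.+1%:R * (x ^+ k * normal_pdf 0 s x) -
     (s ^+ 2)^-1 * (x ^+ k.+2 * normal_pdf 0 s x)).
Proof.
move=> s0; rewrite normal_pdf0E //.
have h2 : is_derive x 1 (fun y : R => - (s ^+ 2 *+ 2)^-1 * y ^+ 2)
    (- (s ^+ 2)^-1 * x).
  apply: is_derive_eq; rewrite /GRing.scale /= mulr1 -mulr2n -[s ^+ 2 *+ 2]mulr_natr.
  by field.
have h3 := is_derive1_comp (is_derive_expR _) h2.
have h4 := is_deriveM (is_deriveX k.+1 (is_derive_id x (1 : R)))
  (is_deriveZ (normal_peak s) h3).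
rewrite (_ : (fun y => _) = id ^+ k.+1 * (normal_peak s \*:
    (expR \o (fun y : R => - (s ^+ 2 *+ 2)^-1 * y ^+ 2)))); last first.
  by apply/funext => y; rewrite !fctE.
apply: is_derive_eq; rewrite !fctE /GRing.scale /= mulr1.
rewrite -[normal_peak s *: _]/(normal_peak s * _) [x ^+ k.+2]exprS.
by rewrite [x ^+ k.+1]exprS; field.
Qed.

Lemma continuous_exp_normal_pdf (s : R) k : s != 0 ->
  continuous (fun x : R => x ^+ k * normal_pdf 0 s x).
Proof.
move=> s0 x; apply: cvgM; first exact: exprn_continuous.
exact: continuous_normal_pdf.
Qed.

(** Makes the boundary term of the integration by parts vanish at infinity. The bound 7 comes from
    comparing the Gaussian with a multiple of [x ^- 8]. *)
Lemma cvg_exp_normal_pdf (s : R) k : 0 < s -> (k <= 7)%N ->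
  (n%:R ^+ k * normal_pdf 0 s n%:R : R) @[n --> \oo] --> (0 : R).
Proof.
move=> s0 k7; have s0' : s != 0 by rewrite gt_eqF.
pose C : R := normal_peak s * (8 * s ^+ 2) ^+ 4.
have ub n : n.+1%:R ^+ k * normal_pdf 0 s n.+1%:R <= C * harmonic n.
  rewrite /harmonic; set x : R := n.+1%:R.
  have x1 : 1 <= x by rewrite /x ler1n.
  have x0 : 0 < x by rewrite (lt_le_trans ltr01).
  rewrite normal_pdf0E // /C mulrCA -mulrA.
  apply: ler_wpM2l; first exact: normal_peak_ge0.
  (* With this [y] the Gaussian factor is [exp (- 4 y)], and [y <= exp y] bounds it by [y ^- 4],
     that is [(8 s^2)^4 / x^8]. The product with [x ^ k] is then at most a constant over [x]. *)
  pose y := x ^+ 2 / (8 * s ^+ 2).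
  have y0 : 0 < y by rewrite divr_gt0 ?exprn_gt0 ?mulr_gt0 ?exprn_gt0.
  have -> : - (s ^+ 2 *+ 2)^-1 * x ^+ 2 = - (4%:R * y).
    by rewrite /y -[s ^+ 2 *+ 2]mulr_natr; field.
  rewrite expRN expRM_natl.
  have hy : y ^+ 4 <= expR y ^+ 4.
    rewrite lerXn2r ?nnegrE ?expR_ge0 ?ltW //.
    by rewrite (lt_le_trans _ (expR_ge1Dx _)) // ltrDr.
  have : (expR y ^+ 4)^-1 <= (y ^+ 4)^-1.
    by rewrite lef_pV2 ?posrE ?exprn_gt0 ?expR_gt0.
  have -> : (y ^+ 4)^-1 = (8 * s ^+ 2) ^+ 4 * (x ^+ 8)^-1.
    by rewrite /y; field; rewrite s0' gt_eqF.
  move=> hE; apply: (le_trans (ler_wpM2l _ hE)); first by rewrite exprn_ge0 ?ltW.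
  rewrite mulrCA; apply: ler_wpM2l.
    by rewrite exprn_ge0 // mulr_ge0 // sqr_ge0.
  rewrite ler_pdivrMr ?exprn_gt0 // [x ^+ 8]exprS mulrA mulVf ?gt_eqF // mul1r.
  by rewrite ler_weXn2l.
rewrite -(cvg_shiftS (fun n => n%:R ^+ k * normal_pdf 0 s n%:R)) /=.
apply: (@squeeze_cvgr _ _ _ _ (fun=> 0) (fun n => C * harmonic n)).
- near=> n; rewrite ub andbT mulr_ge0 ?exprn_ge0 //; exact: normal_pdf_ge0.
- exact: cvg_cst.
- rewrite -[X in _ --> X](mulr0 C); apply: cvgM; first exact: cvg_cst.
  exact: cvg_harmonic.
Unshelve. all: by end_near. Qed.

Lemma half_normal_moment_step (s c : R) k : 0 < s -> ~~ odd k -> (k <= 6)%N ->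
  (\int[mu]_(x in `[0%R, +oo[) (x ^+ k * normal_pdf 0 s x)%:E = c%:E)%E ->
  (\int[mu]_(x in `[0%R, +oo[) (x ^+ k.+2 * normal_pdf 0 s x)%:E =
    (k.+1%:R * s ^+ 2 * c)%:E)%E.
Proof.
move=> s0 ek k6 hc; have s0' : s != 0 by rewrite gt_eqF.
pose g j (x : R) := x ^+ j * normal_pdf 0 s x.
have cg j : continuous (g j) by exact: continuous_exp_normal_pdf.
have ig j n : mu.-integrable `[0%R, n.+1%:R] (EFin \o g j).
  apply: continuous_compact_integrable; first exact: segment_compact.
  by apply: continuous_subspaceT; exact: cg.
have g0 j : ~~ odd j -> forall x, 0 <= g j x.
  by move=> ej x; rewrite mulr_ge0 ?normal_pdf_ge0 ?exprn_even_ge0.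
have mg j : measurable_fun setT (g j) by exact: continuous_measurable_fun.
(* The fundamental theorem of calculus, solved for the higher moment; the antiderivative [g k.+1]
   vanishes at 0. Monotone convergence in [n] then gives the half-line. *)
have key n : (\int[mu]_(x in `[0%R, n.+1%:R]) (g k.+2 x)%:E =
    (k.+1%:R * s ^+ 2)%:E * \int[mu]_(x in `[0%R, n.+1%:R]) (g k x)%:E -
    (s ^+ 2 * g k.+1 n.+1%:R)%:E)%E.
  have d (x : R) := is_derive_exp_normal_pdf x k s0'.
  have := @continuous_FTC2 R
    (fun x => k.+1%:R * g k x - (s ^+ 2)^-1 * g k.+2 x) (g k.+1) 0 n.+1%:R.
  rewrite /= ltr0n => /(_ isT).
  have -> : g k.+1 0 = 0 by rewrite /g expr0n mul0r.
  rewrite sube0 => hFTC.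
  have : (\int[mu]_(x in `[0%R, n.+1%:R])
      (k.+1%:R * g k x - (s ^+ 2)^-1 * g k.+2 x)%:E = (g k.+1 n.+1%:R)%:E)%E.
    apply: hFTC.
    - apply: continuous_subspaceT => x; apply: cvgB; apply: cvgM;
        by [exact: cvg_cst|exact: cg].
    - split; last 2 first.
      + apply: cvg_at_right_filter; exact: cg.
      + apply: cvg_at_left_filter; exact: cg.
      + by move=> x _; have [] := d x.
    - by move=> x _; rewrite derive1E; have [_] := d x.
  under eq_integral do rewrite EFinB.
  rewrite integralB_EFin //; last 2 first.
  - by apply: continuous_compact_integrable; [exact: segment_compact|
      apply: continuous_subspaceT => x; apply: cvgM; [exact: cvg_cst|exact: cg]].
  - by apply: continuous_compact_integrable; [exact: segment_compact|
      apply: continuous_subspaceT => x; apply: cvgM; [exact: cvg_cst|exact: cg]].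
  under eq_integral do rewrite EFinM.
  under [X in (_ - X)%E]eq_integral do rewrite EFinM.
  rewrite !integralZl //; try exact: ig.
  have fin j : (\int[mu]_(x in `[0%R, n.+1%:R]) (g j x)%:E)%E \is a fin_num.
    by apply: integrable_fin_num => //; exact: ig.
  rewrite -(fineK (fin k)) -(fineK (fin k.+2)) -!EFinM -!EFinB => -[h].
  by congr EFin; rewrite -h; field.
have ge0_g j : ~~ odd j -> (\int[mu]_(x in `[0%R, n.+1%:R]) (g j x)%:E)%E
    @[n --> \oo] --> (\int[mu]_(x in `[0%R, +oo[) (g j x)%:E)%E.
  move=> ej; rewrite (cvg_shiftS (fun n => \int[mu]_(x in `[0%R, n%:R]) (g j x)%:E)%E).
  by apply: ge0_cvgn_integral => //; exact: g0.
have cvk : (\int[mu]_(x in `[0%R, n.+1%:R]) (g k x)%:E)%E @[n --> \oo] --> c%:E.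
  by rewrite -hc; exact: ge0_g.
have ek2 : ~~ odd k.+2 by rewrite /= negbK.
suff cv2 : (\int[mu]_(x in `[0%R, n.+1%:R]) (g k.+2 x)%:E)%E @[n --> \oo] -->
    (k.+1%:R * s ^+ 2 * c)%:E.
  exact: (cvg_unique (@ereal_hausdorff R) (ge0_g _ ek2) cv2).
have -> : (k.+1%:R * s ^+ 2 * c)%:E = ((k.+1%:R * s ^+ 2)%:E * c%:E - 0%:E)%E.
  by rewrite sube0 EFinM.
rewrite (eq_cvg _ _ key).
have cv0 : (s ^+ 2 * g k.+1 n.+1%:R)%:E @[n --> \oo] --> (0%:E : \bar R).
  apply: cvg_EFin; first exact: nearW.
  rewrite -[X in _ --> X](mulr0 (s ^+ 2)); apply: cvgM; first exact: cvg_cst.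
  rewrite (cvg_shiftS (fun n => g k.+1 n%:R)); exact: cvg_exp_normal_pdf.
have cvk' := cvgeZl (y := (k.+1%:R * s ^+ 2)%:E) isT cvk.
by apply: (cvgeB _ cvk' cv0).
Qed.

(** The Radon-Nikodym derivative of the normal law and [normal_pdf] have the same integral over
    every measurable set, so they agree almost everywhere. *)
Lemma ge0_integral_normal_prob (s : R) (f : R -> R) : s != 0 ->
  measurable_fun setT f -> (forall x, 0 <= f x) ->
  (\int[normal_prob 0 s]_x (f x)%:E = \int[mu]_x (f x * normal_pdf 0 s x)%:E)%E.
Proof.
move=> s0 mf f0; have dom := normal_prob_dominates (0 : R) s.
have mE : measurable_fun setT (EFin \o f) by exact/measurable_EFinP.
rewrite -(Radon_Nikodym_SigmaFinite.change_of_variables dom _ measurableT mE) //.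
under [RHS]eq_integral do rewrite EFinM.
apply: ae_eq_integral => //.
- apply: emeasurable_funM => //.
  exact: measurable_int (Radon_Nikodym_SigmaFinite.f_integrable dom).
- apply: emeasurable_funM => //; apply/measurable_EFinP.
  exact: measurable_normal_pdf.
- apply: ae_eqe_mul2l; apply: integral_ae_eq => //.
  + exact: Radon_Nikodym_SigmaFinite.f_integrable.
  + by apply/measurable_EFinP; exact: measurable_normal_pdf.
  + by move=> E _ mE'; rewrite -Radon_Nikodym_SigmaFinite.f_integral.
Qed.

Lemma normal_second_fourth_moment (s : R) : 0 < s ->
  (\int[normal_prob 0 s]_x (x ^+ 2)%:E = (s ^+ 2)%:E /\
   \int[normal_prob 0 s]_x (x ^+ 4)%:E = (3 * s ^+ 4)%:E)%E.
Proof.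
move=> s0; have s0' : s != 0 by rewrite gt_eqF.
pose half k := (\int[mu]_(x in `[0%R, +oo[) (x ^+ k * normal_pdf 0 s x)%:E)%E.
have sym k : ~~ odd k ->
    (\int[mu]_x (x ^+ k * normal_pdf 0 s x)%:E = 2%:E * half k)%E.
  move=> ek; rewrite ge0_symfun_integralT.
  - by rewrite /half; congr (_ * integral _ _ _)%E; rewrite set_itvcy.
  - by move=> x; rewrite mulr_ge0 ?exprn_even_ge0 ?normal_pdf_ge0.
  - exact: continuous_exp_normal_pdf.
  - move=> x /=; rewrite normal_pdf0E // sqrrN -[in RHS]mulN1r exprMn.
    by rewrite -signr_odd (negPf ek) expr0 mul1r.
(* Start of the recursion: by symmetry, half of the total mass 1. Two steps lead to [s^2 / 2] and
   [3 s^4 / 2]. *)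
have h0 : half 0%N = (2^-1)%:E.
  have := sym 0%N isT.
  under eq_integral do rewrite expr0 mul1r.
  rewrite integral_normal_pdf => /(congr1 (fun x => (2^-1)%:E * x)%E).
  by rewrite mule1 muleA -EFinM mulVf // mul1e.
have h2 := half_normal_moment_step (k := 0%N) s0 isT isT h0.
have h4 := half_normal_moment_step (k := 2%N) s0 isT isT h2.
split; rewrite ge0_integral_normal_prob //.
- by rewrite sym // /half h2 -EFinM; congr EFin; field.
- by move=> x; exact: sqr_ge0.
- by rewrite sym // /half h4 -EFinM; congr EFin; field.
- by move=> x; exact: exprn_even_ge0.
Qed.

(** Integrability follows from [|x| <= 1 + x^2]. The mean vanishes because the substitution of [- x]
    for [x] exchanges the integrals of the positive and negative parts. *)
Lemma normal_first_moment (s : R) : 0 < s ->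
  (normal_prob 0 s).-integrable setT (EFin : R -> \bar R) /\
  (\int[normal_prob 0 s]_x x%:E = 0)%E.
Proof.
move=> s0; have s0' : s != 0 by rewrite gt_eqF.
have mid : measurable_fun [set: R] (EFin : R -> \bar R) by exact: EFin_measurable.
have int : (normal_prob 0 s).-integrable setT (EFin : R -> \bar R).
  apply/integrableP; split => //.
  apply: (@le_lt_trans _ _ (\int[normal_prob 0 s]_x (1 + x ^+ 2)%:E)%E).
    apply: ge0_le_integral => //=.
    - exact: measurableT_comp.
    - by apply/measurable_EFinP; apply: measurable_funD => //; exact: measurable_funX.
    - move=> x _; rewrite lee_fin; have := sqr_ge0 (`|x| - 1).
      rewrite -[x ^+ 2]real_normK ?num_real //; nra.
  under eq_integral do rewrite EFinD.
  rewrite ge0_integralD //; last 2 first.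
  - by move=> x _; rewrite lee_fin sqr_ge0.
  - by apply/measurable_EFinP; exact: measurable_funX.
  rewrite (normal_second_fourth_moment s0).1 integral_cst // mul1e.
  by rewrite [X in (X + _)%E](probability_setT (normal_prob 0 s)) -EFinD ltry.
split => //; rewrite integralE.
have mmax (b : bool) : measurable_fun setT (fun x : R => Num.max (if b then x else - x) 0).
  by apply: measurable_maxr => //; case: b => //; exact: measurableT_comp.
have sym : (\int[normal_prob 0 s]_x (Num.max x 0)%:E =
            \int[normal_prob 0 s]_x (Num.max (- x) 0)%:E)%E.
  have max0 (x : R) : 0 <= Num.max x 0 by rewrite le_max lexx orbT.
  rewrite !ge0_integral_normal_prob //; last 2 first.
  - exact: (mmax false).
  - exact: (mmax true).
  pose f x := (Num.max x 0 * normal_pdf 0 s x)%:E.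
  have mf : measurable_fun [set: R] f.
    apply/measurable_EFinP.
    by apply: measurable_funM; [exact: (mmax true)|exact: measurable_normal_pdf].
  have f0 x : (0 <= f x)%E by rewrite lee_fin mulr_ge0 ?normal_pdf_ge0.
  transitivity (\int[mu]_(x in `[0%R, +oo[) f x)%E.
    rewrite [RHS]integral_mkcond; apply: eq_integral => x _.
    rewrite patchE; case: ifPn => //; rewrite notin_setE /= in_itv /= andbT.
    by move=> /negP; rewrite -ltNge => /ltW/max_idPr ->; rewrite mul0r.
  rewrite (ge0_integration_by_substitution0 mf f0) integral_mkcond.
  apply: eq_integral => x _; rewrite patchE /f normal_pdf0E // sqrrN.
  case: ifPn => //; rewrite notin_setE /= in_itv /=.
  move=> /negP; rewrite -ltNge => x0; rewrite (_ : Num.max (- x) 0 = 0) ?mul0r //.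
  by apply/max_idPr; rewrite oppr_le0 ltW.
have -> : (\int[normal_prob 0 s]_x ((EFin : R -> \bar R)^\+)%E x =
           \int[normal_prob 0 s]_x (Num.max x 0)%:E)%E.
  by apply: eq_integral => x _; rewrite funeposE EFin_max.
have -> : (\int[normal_prob 0 s]_x ((EFin : R -> \bar R)^\-)%E x =
           \int[normal_prob 0 s]_x (Num.max x 0)%:E)%E.
  by rewrite sym; apply: eq_integral => x _; rewrite funenegE EFin_max.
rewrite subee // ge0_fin_numE; last first.
  by apply: integral_ge0 => x _; rewrite lee_fin le_max lexx orbT.
have /integrableP[_] := int; apply: le_lt_trans; apply: ge0_le_integral => //=.
- by move=> x _; rewrite lee_fin le_max lexx orbT.
- by apply/measurable_EFinP; exact: (mmax true).
- exact: measurableT_comp.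
- by move=> x _; rewrite lee_fin ge_max ler_norm normr_ge0.
Qed.
End NormalMoments.

(** * Joint laws of independent variables and means of products *)

Section IndependentPairs.
Context {d d1 d2 : measure_display} {Omega : measurableType d}
  {T1 : measurableType d1} {T2 : measurableType d2} {R : realType}.
Variables (mu1 : probability T1 R) (mu2 : probability T2 R).

(** Two finite measures that agree on rectangles coincide. The factor [c] is the mass of [m]: it
    allows [m] to be a probability restricted to an event, which is how four variables are reached
    from pairs. *)
Lemma pair_law (m : {measure set Omega -> \bar R}) (X : Omega -> T1)
    (Y : Omega -> T2) (c : \bar R) :
  measurable_fun setT X -> measurable_fun setT Y -> (0 <= c < +oo)%E ->
  (forall A B, measurable A -> measurable B ->
    m (X @^-1` A `&` Y @^-1` B) = (c * (mu1 A * mu2 B))%E) ->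
  forall C, measurable C ->
    m ((fun w => (X w, Y w)) @^-1` C) = (c * (mu1 \x mu2)%E C)%E.
Proof.
move=> mX mY /andP[c0 coo] hAB C mC.
have mXY : measurable_fun setT (fun w => (X w, Y w)) by exact: measurable_fun_pair.
pose XY : {mfun Omega >-> (T1 * T2)%type} :=
  HB.pack (fun w => (X w, Y w)) (isMeasurableFun.Build _ _ _ _ _ mXY).
have c0' : 0 <= fine c by exact: fine_ge0.
have cE : (NngNum c0')%:num%:E = c by rewrite /= fineK // ge0_fin_numE.
pose G : set (set (T1 * T2)) :=
  [set C | exists A, measurable A /\ exists B, measurable B /\ C = A `*` B].
have -> : (c * (mu1 \x mu2)%E C)%E = mscale (NngNum c0') (mu1 \x mu2)%E C.
  by rewrite /mscale cE.
apply: (measure_unique G (fun=> setT) _ _ _ _ (pushforward m XY)) => //.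
- rewrite measurable_prod_measurableType; congr (<<s _ >>).
  rewrite predeqE; split => [[A mA [B mB <-]]|[A [mA [B [mB ->]]]]].
    by exists A; split => //; exists B.
  by exists A => //; exists B.
- move=> _ _ [A1 [mA1 [A2 [mA2 ->]]]] [B1 [mB1 [B2 [mB2 ->]]]].
  rewrite -setXI; exists (A1 `&` B1); split; first exact: measurableI.
  by exists (A2 `&` B2); split => //; exact: measurableI.
- by move=> _; exists setT; split => //; exists setT; rewrite setXTT.
- by rewrite bigcup_const //; exists 0%N.
- move=> _ [A [mA [B [mB ->]]]]; transitivity (c * (mu1 A * mu2 B))%E.
    by rewrite -hAB.
  by rewrite -product_measure1E // -[X in (X * _)%E = _]cE.
- move=> _; rewrite /pushforward -setXTT.
  have : (m (X @^-1` setT `&` Y @^-1` setT) < +oo)%E.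
    by rewrite hAB // !probability_setT !mule1.
  exact.
Qed.

Lemma integrable_prod_mul (f : T1 -> R) (g : T2 -> R) (a b : R) :
  mu1.-integrable setT (EFin \o f) -> mu2.-integrable setT (EFin \o g) ->
  (\int[mu1]_x (f x)%:E = a%:E)%E -> (\int[mu2]_y (g y)%:E = b%:E)%E ->
  (mu1 \x mu2)%E.-integrable setT (fun z => (f z.1 * g z.2)%:E) /\
  (\int[(mu1 \x mu2)%E]_z (f z.1 * g z.2)%:E = (a * b)%:E)%E.
Proof.
move=> if_ ig fa gb.
have mf : measurable_fun setT f by apply/measurable_EFinP; exact: measurable_int if_.
have mg : measurable_fun setT g by apply/measurable_EFinP; exact: measurable_int ig.
have mfg : measurable_fun setT (fun z : T1 * T2 => (f z.1 * g z.2)%:E).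
  apply/measurable_EFinP; apply: measurable_funM.
    exact: measurableT_comp mf measurable_fst.
  exact: measurableT_comp mg measurable_snd.
have int : (mu1 \x mu2)%E.-integrable setT (fun z => (f z.1 * g z.2)%:E).
  apply/integrable12ltyP => //=.
  have /integrableP[_ ifoo] := if_; have /integrableP[_ igoo] := ig.
  under eq_integral => x _.
    under eq_integral do rewrite normrM EFinM.
    rewrite ge0_integralZl //; last exact/measurable_EFinP/measurableT_comp.
    over.
  have mnf : measurable_fun setT (fun x => (`|f x|%:E : \bar R)).
    by apply/measurable_EFinP; exact: measurableT_comp.
  rewrite ge0_integralZr //; try exact: integral_ge0.
  by rewrite lte_mul_pinfty // ?integral_ge0 // ge0_fin_numE // integral_ge0.
split => //; rewrite -integral12_prod_meas1 // /fubini_F /=.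
under eq_integral => x _.
  under eq_integral do rewrite EFinM.
  rewrite integralZl // gb; over.
by rewrite integralZr // fa -EFinM.
Qed.

Lemma independent_integral_mul (P : probability Omega R) (X : Omega -> T1)
    (Y : Omega -> T2) (f : T1 -> R) (g : T2 -> R) (a b : R) :
  measurable_fun setT X -> measurable_fun setT Y ->
  (forall A B, measurable A -> measurable B ->
    P (X @^-1` A `&` Y @^-1` B) = (mu1 A * mu2 B)%E) ->
  mu1.-integrable setT (EFin \o f) -> mu2.-integrable setT (EFin \o g) ->
  (\int[mu1]_x (f x)%:E = a%:E)%E -> (\int[mu2]_y (g y)%:E = b%:E)%E ->
  P.-integrable setT (fun w => (f (X w) * g (Y w))%:E) /\
  (\int[P]_w (f (X w) * g (Y w))%:E = (a * b)%:E)%E.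
Proof.
move=> mX mY hAB if_ ig fa gb.
have [int ab] := integrable_prod_mul if_ ig fa gb.
have mXY : measurable_fun setT (fun w => (X w, Y w)) by exact: measurable_fun_pair.
pose XY : {mfun Omega >-> (T1 * T2)%type} :=
  HB.pack (fun w => (X w, Y w)) (isMeasurableFun.Build _ _ _ _ _ mXY).
have law C : measurable C -> pushforward P XY C = (mu1 \x mu2)%E C.
  move=> mC; rewrite -[RHS]mul1e; apply: pair_law => //; first by rewrite lee01 ltry.
  by move=> A B mA mB; rewrite mul1e; exact: hAB.
have mF : measurable_fun setT (fun z : T1 * T2 => (f z.1 * g z.2)%:E).
  exact: measurable_int int.
have intXY : P.-integrable setT ((fun z => (f z.1 * g z.2)%:E) \o XY).
  apply/integrableP; split; first exact: measurableT_comp.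
  have /integrableP[_] := int; apply: le_lt_trans.
  rewrite [leRHS](_ : _ = \int[pushforward P XY]_z `|(f z.1 * g z.2)%:E|)%E; last first.
    by apply: eq_measure_integral => C mC _; exact/esym/law.
  rewrite ge0_integral_pushforward //; last exact: measurableT_comp.
split => //; rewrite -ab.
rewrite [RHS](_ : _ = \int[pushforward P XY]_z (f z.1 * g z.2)%:E)%E; last first.
  by apply: eq_measure_integral => C mC _; exact/esym/law.
by rewrite integral_pushforward.
Qed.

End IndependentPairs.

Section HasIntegral.
Context {d : measure_display} {Omega : measurableType d} {R : realType}.
Variable mu : {measure set Omega -> \bar R}.

(** Keeping integrability and value together lets linear combinations be integrated without separate
    side conditions. *)
Definition has_integral (X : Omega -> R) (e : R) : Prop :=
  mu.-integrable setT (EFin \o X) /\ (\int[mu]_w (X w)%:E = e%:E)%E.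

Lemma has_integral0 : has_integral (fun=> 0) 0.
Proof.
split; last by rewrite integral0.
apply/integrableP; split; first exact: measurable_cst.
by rewrite (eq_integral (cst 0%E)) ?integral0 // => w _; rewrite /= normr0.
Qed.

Lemma has_integralD X Y a b : has_integral X a -> has_integral Y b ->
  has_integral (fun w => X w + Y w) (a + b).
Proof.
move=> [iX eX] [iY eY]; split; first exact: integrableD iX iY.
by rewrite integralD_EFin // eX eY.
Qed.

Lemma has_integralZ c X a : has_integral X a -> has_integral (fun w => c * X w) (c * a).
Proof.
move=> [iX eX]; split; first exact: integrableZl iX.
by under eq_integral do rewrite EFinM; rewrite integralZl // eX.
Qed.

Lemma has_integral_sum I (r : seq I) (X : I -> Omega -> R) (a : I -> R) :
  (forall i, has_integral (X i) (a i)) ->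
  has_integral (fun w => \sum_(i <- r) X i w) (\sum_(i <- r) a i).
Proof.
move=> h; elim: r => [|i r IH].
  by rewrite big_nil; under eq_fun do rewrite big_nil; exact: has_integral0.
by rewrite big_cons; under eq_fun do rewrite big_cons; exact: has_integralD.
Qed.

Lemma has_integral_sqr_sum n (U : 'I_n -> Omega -> R) (v : R) :
  (forall i, has_integral (fun w => U i w ^+ 2) v) ->
  (forall i k, i != k -> has_integral (fun w => U i w * U k w) 0) ->
  has_integral (fun w => (\sum_i U i w) ^+ 2) (n%:R * v).
Proof.
move=> h1 h2.
have -> : (fun w => (\sum_i U i w) ^+ 2) =
    (fun w => \sum_i \sum_k U i w * U k w).
  by apply/funext => w; rewrite expr2 big_distrlr.
have -> : n%:R * v = \sum_(i < n) \sum_(k < n) if i == k then v else 0.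
  rewrite (eq_bigr (fun=> v)) ?sumr_const ?card_ord ?mulr_natl // => i _.
  by rewrite (bigD1 i) //= eqxx big1 ?addr0 // => k; rewrite eq_sym => /negPf ->.
apply: has_integral_sum => i; apply: has_integral_sum => k.
by case: eqVneq => [->|/h2 //]; under eq_fun do rewrite -expr2; exact: h1.
Qed.

End HasIntegral.

Lemma has_integral_cst (d : measure_display) (Omega : measurableType d)
  (R : realType) (P : probability Omega R) c : has_integral P (fun=> c) c.
Proof.
split; first exact: finite_measure_integrable_cst.
by rewrite integral_cst // [X in (_ * X)%E](probability_setT P) mule1.
Qed.

Lemma integrable_normal_pow (R : realType) (s : R) k : 0 < s ->
  k \in [:: 1%N; 2%N; 4%N] ->
  (normal_prob 0 s).-integrable setT (EFin \o (fun x : R => x ^+ k)).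
Proof.
move=> s0; have [m2 m4] := normal_second_fourth_moment s0.
have even j c : ~~ odd j -> (\int[normal_prob 0 s]_x (x ^+ j)%:E = c%:E)%E ->
    (normal_prob 0 s).-integrable setT (EFin \o (fun x : R => x ^+ j)).
  move=> ej hj; apply/integrableP; split.
    by apply/measurable_EFinP; exact: measurable_funX.
  under eq_integral => x _ do rewrite /= ger0_norm ?exprn_even_ge0 //.
  by rewrite hj ltry.
rewrite !inE => /or3P[] /eqP ->; [|exact: even m2|exact: even m4].
exact: (normal_first_moment s0).1.
Qed.

Lemma gaussian_moments (R : realType) (s : R) : 0 < s ->
  [/\ (\int[normal_prob 0 s]_x (x ^+ 1)%:E = 0%:E)%E,
  (\int[normal_prob 0 s]_x (x ^+ 2)%:E = (s ^+ 2)%:E)%E &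
  (\int[normal_prob 0 s]_x (x ^+ 4)%:E = (3 * s ^+ 4)%:E)%E].
Proof.
move=> s0; have [m2 m4] := normal_second_fourth_moment s0.
by split=> //; exact: (normal_first_moment s0).2.
Qed.

(** * Arrays of independent centred Gaussian variables *)

Section GaussianArray.
Context {d : measure_display} {Omega : measurableType d} {R : realType}.
Variable P : probability Omega R.

(** The rule runs over the whole index set, in the shape that [standard_wiener] provides; filling in
    [setT] gives the law of any subfamily. *)
Definition gaussian_array (s : R) (I : finType) (Z : I -> Omega -> R) : Prop :=
  (forall k, measurable_fun setT (Z k)) /\
  forall A : I -> set R, (forall k, measurable (A k)) ->
    P [set w | forall k, A k (Z k w)] = (\prod_k normal_prob 0 s (A k))%E.

Context (s : R) (I : finType) (Z : I -> Omega -> R).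
Hypothesis s0 : 0 < s.
Hypothesis gZ : gaussian_array s Z.

Local Notation N := (normal_prob 0 s : probability _ R).

Let mZ k : measurable_fun setT (Z k). Proof. exact: gZ.1. Qed.

Lemma gaussian_array_finset (S : {set I}) (A : I -> set R) :
  (forall k, measurable (A k)) ->
  P [set w | forall k, k \in S -> A k (Z k w)] = (\prod_(k in S) N (A k))%E.
Proof.
move=> mA; pose B k := if k \in S then A k else setT.
have mB k : measurable (B k) by rewrite /B; case: ifP.
rewrite [RHS]big_mkcond /= (eq_bigr (fun k => N (B k))).
  rewrite -gZ.2 //; congr (P _); apply/seteqP; split=> w /= h k.
    by rewrite /B; case: ifP => // /h.
  by move=> kS; have := h k; rewrite /B kS.
by move=> k _; rewrite /B; case: ifP => // _; rewrite probability_setT.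
Qed.

Lemma gaussian_array_pair a b (A B : set R) : a != b ->
  measurable A -> measurable B ->
  P (Z a @^-1` A `&` Z b @^-1` B) = (N A * N B)%E.
Proof.
move=> ab mA mB; pose C k := if k == a then A else B.
have mC k : measurable (C k) by rewrite /C; case: ifP.
have := gaussian_array_finset [set a; b] mC.
rewrite big_setU1 ?inE //= big_set1 {2 3}/C eqxx eq_sym (negPf ab) => <-.
congr (P _); apply/seteqP; split=> w /=.
  move=> [hA hB] k; rewrite !inE /C; by have [->|ka /= /eqP ->] := eqVneq k a.
move=> h; split; [have := h a|have := h b]; rewrite !inE eqxx ?orbT /C.
  by rewrite eqxx; exact.
by rewrite eq_sym (negPf ab); exact.
Qed.

(** The product rule is known on rectangles. [pair_law] is applied twice: with [P] restricted to a
    rectangle event of the first pair it frees [B], and with [P] restricted to the event of [B] it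
    frees [A]. *)
Lemma gaussian_array_quadruple a b c e (A B : set (R * R)) : uniq [:: a; b; c; e] ->
  measurable A -> measurable B ->
  P ((fun w => (Z a w, Z b w)) @^-1` A `&` (fun w => (Z c w, Z e w)) @^-1` B) =
  ((N \x N) A * (N \x N) B)%E.
Proof.
move=> un mA mB.
have rect A1 A2 A3 A4 : measurable A1 -> measurable A2 -> measurable A3 ->
    measurable A4 -> P ((Z a @^-1` A1 `&` Z b @^-1` A2) `&`
                        (Z c @^-1` A3 `&` Z e @^-1` A4)) =
      (N A1 * N A2 * (N A3 * N A4))%E.
  move=> m1 m2 m3 m4; move: un; rewrite /= !inE !negb_or -!andbA.
  move=> /and5P[ab ac ae bc /andP[be /andP[ce _]]].
  pose C k := if k == a then A1 else if k == b then A2 else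
              if k == c then A3 else A4.
  have mC k : measurable (C k) by rewrite /C; do !case: ifP.
  have [Ca Cb Cc Ce] : [/\ C a = A1, C b = A2, C c = A3 & C e = A4].
    rewrite /C !eqxx (eq_sym b) (eq_sym c a) (eq_sym c b) (eq_sym e).
    rewrite (eq_sym e b) (eq_sym e c).
    by rewrite !(negPf ab, negPf ac, negPf ae, negPf bc, negPf be, negPf ce).
  have := gaussian_array_finset (a |: (b |: (c |: [set e]))) mC.
  rewrite !big_setU1 ?inE ?negb_or ?ab ?ac ?ae ?bc ?be ?ce //= big_set1.
  rewrite Ca Cb Cc Ce !muleA => <-.
  congr (P _); apply/seteqP; split=> w /=.
    move=> [[h1 h2] [h3 h4]] k; rewrite !inE => /or4P[] /eqP ->;
    by rewrite ?Ca ?Cb ?Cc ?Ce.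
  move=> h; have := (h a, h b, h c, h e); rewrite Ca Cb Cc Ce !inE !eqxx ?orbT.
  by move=> [[[h1 h2] h3] h4]; do !split; [exact: h1|exact: h2|exact: h3|exact: h4].
have mpre k (D : set R) : measurable D -> measurable (Z k @^-1` D).
  by move=> mD; rewrite -[X in measurable X]setTI; exact: mZ.
have fin (D : set R) : measurable D -> N D \is a fin_num.
  exact: (fin_num_measure N).
have step1 A1 A2 : measurable A1 -> measurable A2 ->
    P ((Z a @^-1` A1 `&` Z b @^-1` A2) `&` (fun w => (Z c w, Z e w)) @^-1` B) =
    (N A1 * N A2 * (N \x N) B)%E.
  move=> m1 m2.
  have mE : measurable (Z a @^-1` A1 `&` Z b @^-1` A2).
    by apply: measurableI; exact: mpre.
  rewrite setIC -[LHS]/(mrestr P mE _).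
  have := @pair_law _ _ _ _ _ _ _ N N (mrestr P mE) (Z c) (Z e) (N A1 * N A2)%E
    (mZ c) (mZ e).
  apply => //; first by rewrite mule_ge0 //= ltey_eq fin_numM ?fin.
  move=> A3 A4 m3 m4; rewrite -rect //; exact: (congr1 P (setIC _ _)).
have mX : measurable ((fun w => (Z c w, Z e w)) @^-1` B).
  by rewrite -[X in measurable X]setTI; apply: measurable_fun_pair.
rewrite -[LHS]/(mrestr P mX _) muleC.
have := @pair_law _ _ _ _ _ _ _ N N (mrestr P mX) (Z a) (Z b) ((N \x N) B)%E
  (mZ a) (mZ b).
apply => //.
  rewrite measure_ge0 /=; apply: (@le_lt_trans _ _ ((N \x N)%E (setT `*` setT))).
    by apply: le_measure; rewrite ?inE ?setXTT.
  by rewrite product_measure1E // ltey_eq fin_numM // (fin _ measurableT).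
by move=> A1 A2 m1 m2; rewrite muleC -step1.
Qed.

Lemma gaussian_array_mean k (f : R -> R) e :
  N.-integrable setT (EFin \o f) -> (\int[N]_x (f x)%:E = e%:E)%E ->
  has_integral P (fun w => f (Z k w)) e.
Proof.
move=> if_ fe.
have mZk : @measurable_fun _ _ Omega (measurableTypeR R) setT (Z k) := mZ k.
pose X : {mfun Omega >-> measurableTypeR R} :=
  HB.pack (Z k) (isMeasurableFun.Build _ _ _ _ _ mZk).
have law (A : set (measurableTypeR R)) : measurable A -> pushforward P X A = N A.
  move=> mA; have := gaussian_array_finset [set k] (fun=> mA).
  rewrite big_set1 => <-; congr (P _); apply/seteqP; split=> w /=.
    by move=> h j; rewrite inE => /eqP ->.
  by apply; rewrite inE.
have mf : measurable_fun setT (EFin \o f) by exact: measurable_int if_.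
have iX : P.-integrable setT ((EFin \o f) \o X).
  apply/integrableP; split; first exact: measurableT_comp.
  have /integrableP[_] := if_; apply: le_lt_trans.
  rewrite [leRHS](_ : _ = \int[pushforward P X]_z `|(EFin \o f) z|)%E; last first.
    by apply: eq_measure_integral => C mC _; exact/esym/law.
  by rewrite ge0_integral_pushforward //; exact: measurableT_comp.
split=> //; rewrite -fe.
rewrite [RHS](_ : _ = \int[pushforward P X]_z (EFin \o f) z)%E; last first.
  by apply: eq_measure_integral => C mC _; exact/esym/law.
by rewrite integral_pushforward.
Qed.

Lemma gaussian_array_mul_mean a b (f g : R -> R) e1 e2 : a != b ->
  N.-integrable setT (EFin \o f) -> N.-integrable setT (EFin \o g) ->
  (\int[N]_x (f x)%:E = e1%:E)%E -> (\int[N]_x (g x)%:E = e2%:E)%E ->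
  has_integral P (fun w => f (Z a w) * g (Z b w)) (e1 * e2).
Proof.
move=> ab; apply: (@independent_integral_mul _ _ _ _ _ _ _ N N P (Z a) (Z b)) => //.
all: try exact: mZ.
by move=> A B mA mB; exact: gaussian_array_pair.
Qed.

Lemma gaussian_array_sqr_mean k : has_integral P (fun w => Z k w ^+ 2) (s ^+ 2).
Proof.
have [_ m2 _] := gaussian_moments s0; apply: (gaussian_array_mean k _ m2).
exact: integrable_normal_pow.
Qed.

Lemma gaussian_array_quadruple_mean a b c e : uniq [:: a; b; c; e] ->
  has_integral P (fun w => (Z a w * Z b w) * (Z c w * Z e w)) 0.
Proof.
move=> un; have [m1 _ _] := gaussian_moments s0.
have i1 := integrable_normal_pow (k := 1%N) s0 isT.
have [ii mm] := @integrable_prod_mul _ _ _ _ _ N N _ _ _ _ i1 i1 m1 m1.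
rewrite mulr0 in mm.
have := @independent_integral_mul _ _ _ _ _ _ _ (N \x N)%E (N \x N)%E P
  (fun w => (Z a w, Z b w)) (fun w => (Z c w, Z e w)) (fun z => z.1 ^+ 1 * z.2 ^+ 1)
  (fun z => z.1 ^+ 1 * z.2 ^+ 1) 0 0.
rewrite mulr0; apply => //; try exact: (measurable_fun_pair (mZ _) (mZ _)).
by move=> A B mA mB; exact: gaussian_array_quadruple.
Qed.

End GaussianArray.

(** Summands with different [i] are uncorrelated, so variances add. One summand has variance [2 s^4]
    if [j = l] and [s^4] otherwise, which [(j == l).+1] encodes. For [j != l] the cross terms
    involve four distinct variables. *)
Lemma gaussian_array_lln (d : measure_display) (Omega : measurableType d)
    (R : realType) (P : probability Omega R) (s : R) (n r : nat)
    (Z : 'I_n * 'I_r -> Omega -> R) (j l : 'I_r) :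
  0 < s -> gaussian_array P s Z ->
  has_integral P
    (fun w => (\sum_(i < n) (Z (i, j) w * Z (i, l) w - s ^+ 2 * (j == l)%:R)) ^+ 2)
    (n%:R * (s ^+ 4 * (j == l).+1%:R)).
Proof.
move=> s0 gZ; have sq := gaussian_array_sqr_mean s0 gZ.
have [m1 m2 m4] := gaussian_moments s0.
have ip := integrable_normal_pow s0.
have ne (i k : 'I_n) (a b : 'I_r) : (i != k) || (a != b) -> (i, a) != (k, b).
  by rewrite xpair_eqE negb_and.
case: (eqVneq j l) => [->|jl] /=.
- pose U (i : 'I_n) w := Z (i, l) w ^+ 2 + - s ^+ 2.
  have -> : (fun w => (\sum_(i < n) (Z (i, l) w * Z (i, l) w - s ^+ 2 * true%:R)) ^+ 2) =
      (fun w => (\sum_i U i w) ^+ 2).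
    by apply/funext => w; congr (_ ^+ 2); apply: eq_bigr => i _; rewrite mulr1 -expr2.
  apply: has_integral_sqr_sum => [i|i k ik].
  (* The mean of [Z^4 - 2 s^2 Z^2 + s^4] is [3 s^4 - 2 s^4 + s^4]. *)
  + have := has_integralD (has_integralD (gaussian_array_mean gZ (i, l) (ip 4%N isT) m4)
      (has_integralZ (- (s ^+ 2 *+ 2)) (sq (i, l)))) (has_integral_cst P (s ^+ 4)).
    have -> : 3 * s ^+ 4 + - (s ^+ 2 *+ 2) * s ^+ 2 + s ^+ 4 = s ^+ 4 * 2.
      by rewrite -[s ^+ 2 *+ 2]mulr_natr; ring.
    congr (has_integral P _ _); apply/funext => w; rewrite /U.
    by rewrite -[s ^+ 2 *+ 2]mulr_natr; ring.
  + have nik : (i, l) != (k, l) by rewrite ne // ik.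
    have h := gaussian_array_mul_mean gZ nik (ip 2%N isT) (ip 2%N isT) m2 m2.
    have := has_integralD (has_integralD (has_integralD h (has_integralZ (- s ^+ 2) (sq (i, l))))
      (has_integralZ (- s ^+ 2) (sq (k, l)))) (has_integral_cst P (s ^+ 4)).
    have -> : s ^+ 2 * s ^+ 2 + - s ^+ 2 * s ^+ 2 + - s ^+ 2 * s ^+ 2 + s ^+ 4 = 0.
      by ring.
    by congr (has_integral P _ _); apply/funext => w; rewrite /U; ring.
- pose U (i : 'I_n) w := Z (i, j) w * Z (i, l) w.
  have -> : (fun w => (\sum_(i < n) (Z (i, j) w * Z (i, l) w - s ^+ 2 * false%:R)) ^+ 2) =
      (fun w => (\sum_i U i w) ^+ 2).
    by apply/funext => w; congr (_ ^+ 2); apply: eq_bigr => i _; rewrite mulr0 subr0.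
  apply: has_integral_sqr_sum => [i|i k ik].
  + have nik : (i, j) != (i, l) by rewrite ne // jl orbT.
    have := gaussian_array_mul_mean gZ nik (ip 2%N isT) (ip 2%N isT) m2 m2.
    have -> : s ^+ 2 * s ^+ 2 = s ^+ 4 * 1 by ring.
    by congr (has_integral P _ _); apply/funext => w; rewrite /U exprMn.
  + apply: (gaussian_array_quadruple_mean s0 gZ).
    have lj : l != j by rewrite eq_sym.
    by rewrite /= !inE !negb_or !ne ?ik ?jl ?lj ?orbT.
Qed.
(** * Mean error of the realized covariance *)

Section MeanLe.
Context {d : measure_display} {Omega : measurableType d} {R : realType}.
Variable P : probability Omega R.

Definition mean_le (f : Omega -> R) (e : R) : Prop :=
  [/\ measurable_fun setT f, forall w, 0 <= f w &
      (\int[P]_w (f w)%:E <= e%:E)%E].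

Lemma mean_le_weaken (f : Omega -> R) e e' : e <= e' -> mean_le f e -> mean_le f e'.
Proof. by move=> ee' [mf f0 fe]; split => //; rewrite (le_trans fe) ?lee_fin. Qed.

Lemma mean_le_dominated (f g : Omega -> R) e : measurable_fun setT f ->
  (forall w, 0 <= f w <= g w) -> mean_le g e -> mean_le f e.
Proof.
move=> mf fg [mg g0 ge]; split => // [w|]; first by case/andP: (fg w).
apply: le_trans ge; apply: ge0_le_integral => //.
- by move=> w _; rewrite lee_fin; case/andP: (fg w).
- exact/measurable_EFinP.
- exact/measurable_EFinP.
- by move=> w _; rewrite lee_fin; case/andP: (fg w).
Qed.

Lemma mean_leD f g a b : mean_le f a -> mean_le g b ->
  mean_le (fun w => f w + g w) (a + b).
Proof.
move=> [mf f0 fa] [mg g0 gb]; split; first exact: measurable_funD.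
  by move=> w; exact: addr_ge0.
under eq_integral do rewrite EFinD.
rewrite ge0_integralD //; try exact/measurable_EFinP.
- by rewrite EFinD leeD.
- by move=> w _; rewrite lee_fin.
- by move=> w _; rewrite lee_fin.
Qed.

Lemma mean_leZ c f a : 0 <= c -> mean_le f a -> mean_le (fun w => c * f w) (c * a).
Proof.
move=> c0 [mf f0 fa]; split; first exact: measurable_funM.
  by move=> w; exact: mulr_ge0.
under eq_integral do rewrite EFinM.
rewrite ge0_integralZl //; try exact/measurable_EFinP.
  by rewrite EFinM lee_wpmul2l.
by move=> w _; rewrite lee_fin.
Qed.

Lemma mean_le_cst c : 0 <= c -> mean_le (fun=> c) c.
Proof.
move=> c0; split => //.
by rewrite integral_cst // [X in (_ * X)%E](probability_setT P) mule1.
Qed.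

Lemma mean_le_sum I (r : seq I) (f : I -> Omega -> R) (a : I -> R) :
  (forall i, mean_le (f i) (a i)) ->
  mean_le (fun w => \sum_(i <- r) f i w) (\sum_(i <- r) a i).
Proof.
move=> h; elim: r => [|i r IH].
  by rewrite big_nil; under eq_fun do rewrite big_nil; exact: mean_le_cst.
by rewrite big_cons; under eq_fun do rewrite big_cons; exact: mean_leD.
Qed.

Lemma has_integral_mean_le (f : Omega -> R) e :
  (forall w, 0 <= f w) -> has_integral P f e -> mean_le f e.
Proof.
move=> f0 [fi fe]; split => //; last by rewrite fe.
by apply/measurable_EFinP; exact: measurable_int fi.
Qed.

(** The pointwise inequality [2 |f| <= t f^2 + 1 / t] stands in for Cauchy-Schwarz; [t] of order
    [1 / sqrt v] gives the order [sqrt v]. *)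
Lemma mean_le_norm (f : Omega -> R) v t : 0 < t -> measurable_fun setT f ->
  mean_le (fun w => f w ^+ 2) v ->
  mean_le (fun w => `|f w|) ((t * v + t^-1) / 2).
Proof.
move=> t0 mf hf; have ti : 0 <= t^-1 by rewrite invr_ge0 ltW.
have i2 : 0 <= 2^-1 :> R by rewrite invr_ge0.
have := mean_leZ i2 (mean_leD (mean_leZ (ltW t0) hf) (mean_le_cst ti)).
rewrite [2^-1 * _]mulrC; apply: mean_le_dominated; first exact: measurableT_comp.
move=> w; rewrite normr_ge0 /=.
have h2 := sqr_ge0 (t * `|f w| - 1); rewrite -[f w ^+ 2]real_normK ?num_real //.
rewrite -(ler_pM2l t0).
have -> : t * (2^-1 * (t * `|f w| ^+ 2 + t^-1)) = ((t * `|f w|) ^+ 2 + 1) / 2.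
  by field; rewrite gt_eqF.
nra.
Qed.

Lemma markov_mean_le (f : Omega -> R) (a e : R) : 0 < e -> mean_le f a ->
  (P [set w | e <= f w]%R <= (a / e)%:E)%E.
Proof.
move=> e0 [mf f0 fa].
have := @le_integral_comp_abse _ _ _ P _ measurableT (EFin \o f) e id
  (@measurable_id _ _ _) (fun r h => h) _ _ e0.
have mE : measurable_fun setT (EFin \o f) by exact/measurable_EFinP.
move=> h; have {h} := h (fun x y _ _ xy => xy) mE; rewrite setTI => h.
rewrite EFinM lee_pdivlMr // muleC; apply: le_trans fa.
under eq_integral => w _ do rewrite -[X in X%:E]ger0_norm //.
rewrite (_ : [set w | _] = [set x | e%:E <= `|(EFin \o f) x|]%E) //.
by apply/funext => w; rewrite /= lee_fin ger0_norm.
Qed.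

End MeanLe.

Lemma sqr_sum_le (R : realType) n (x : 'I_n -> R) :
  (\sum_i x i) ^+ 2 <= n%:R * \sum_i x i ^+ 2.
Proof.
rewrite expr2 big_distrlr /=.
apply: (@le_trans _ _ (\sum_(i < n) \sum_(j < n) (x i ^+ 2 + x j ^+ 2) / 2)).
  apply: ler_sum => i _; apply: ler_sum => j _.
  have := sqr_ge0 (x i - x j); nra.
rewrite (eq_bigr (fun i => (n%:R * x i ^+ 2 + \sum_j x j ^+ 2) / 2)); last first.
  move=> i _; rewrite -mulr_suml big_split /= sumr_const card_ord.
  by rewrite -[x i ^+ 2 *+ n]mulr_natl.
rewrite -mulr_suml big_split /= -mulr_sumr sumr_const card_ord.
by rewrite -[X in (_ + X) / 2]mulr_natl; lra.
Qed.

(** Here [u] stands for drift, of order [h], and [v] for noise, of order [s = sqrt h]. The weights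
    bring both terms to order [h^(3/2)]; [s <= 1] lets the first also absorb the product
    [u * u']. *)
Lemma cross_term_le (R : realType) (s u v u' v' : R) : 0 < s <= 1 ->
  `|(u + v) * (u' + v') - v * v'| <=
  s^-1 * (u ^+ 2 + u' ^+ 2) + s * (v ^+ 2 + v' ^+ 2).
Proof.
move=> /andP[s0 s1].
have ti : 1 <= s^-1 by rewrite invf_ge1.
have st : s * s^-1 = 1 by rewrite divff // gt_eqF.
have amgm x y : `|x * y| <= (s^-1 * x ^+ 2 + s * y ^+ 2) / 2.
  rewrite normrM -[x ^+ 2]real_normK ?num_real // -[y ^+ 2]real_normK ?num_real //.
  rewrite -(ler_pM2l s0).
  have -> : s * ((s^-1 * `|x| ^+ 2 + s * `|y| ^+ 2) / 2) =
      (`|x| ^+ 2 + (s * `|y|) ^+ 2) / 2 by field; rewrite gt_eqF.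
  have := sqr_ge0 (`|x| - s * `|y|); nra.
have -> : (u + v) * (u' + v') - v * v' = u * u' + u * v' + u' * v by ring.
have h1 : `|u * u'| <= s^-1 * (u ^+ 2 + u' ^+ 2) / 2.
  have : `|u * u'| <= (u ^+ 2 + u' ^+ 2) / 2.
    rewrite normrM -[u ^+ 2]real_normK ?num_real // -[u' ^+ 2]real_normK ?num_real //.
    have := sqr_ge0 (`|u| - `|u'|); nra.
  have := sqr_ge0 u; have := sqr_ge0 u'; nra.
have h2 := amgm u v'; have h3 := amgm u' v.
apply: (le_trans (ler_normD _ _)); apply: (le_trans (lerD (ler_normD _ _) (lexx _))).
have h4 : 0 <= s * (v ^+ 2 + v' ^+ 2).
  by apply: mulr_ge0; [exact: ltW|rewrite addr_ge0 ?sqr_ge0].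
lra.
Qed.

Section RealizedCovariance.
Context {d : measure_display} {Omega : measurableType d} {R : realType}.
Variable P : probability Omega R.

Lemma mean_le_linear_sqr m p (H : 'M[R]_(p, m)) (e : Omega -> 'cV[R]_m) (v : R) a :
  random_vector e -> (forall c, mean_le P (fun w => e w c 0 ^+ 2) v) ->
  mean_le P (fun w => (H *m e w) a 0 ^+ 2) (m%:R * (\sum_c H a c ^+ 2) * v).
Proof.
move=> me he; have aK := @measurable_fun_algebra _ Omega R.
have : mean_le P (fun w => m%:R * \sum_c (H a c ^+ 2 * e w c 0 ^+ 2))
    (m%:R * (\sum_c H a c ^+ 2) * v).
  rewrite -mulrA mulr_suml; apply: mean_leZ => //.
  by apply: mean_le_sum => c; apply: mean_leZ => //; exact: sqr_ge0.
apply: mean_le_dominated.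
  by apply: (fun_algebraX aK); apply: (entrywise_mul aK).
move=> w; rewrite sqr_ge0 mxE; apply: (le_trans (sqr_sum_le _)).
by under eq_bigr do rewrite exprMn.
Qed.

(** [e] may depend on [z], so every product involving [e] is bounded by [cross_term_le]; the pure
    noise products are compared with [G *m G^T] by [gaussian_array_lln]. *)
Lemma realized_cov_mean_error m p r (H : 'M[R]_(p, m)) (G : 'M[R]_(p, r))
    (K : R) (a b : 'I_p) : 0 <= K ->
  exists C, forall n (h : R) (e : 'I_n -> Omega -> 'cV[R]_m)
      (z : 'I_n -> Omega -> 'cV[R]_r), (0 < n)%N -> 0 < h <= 1 ->
    (forall i, random_vector (e i)) ->
    (forall i c, mean_le P (fun w => e i w c 0 ^+ 2) (K * h ^+ 2)) ->
    gaussian_array P (Num.sqrt h) (fun ij w => z ij.1 w ij.2 0) ->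
    exists2 g, mean_le P g (C * ((Num.sqrt n%:R)^-1 + Num.sqrt h)) &
      forall w, `|((n%:R * h)^-1 *: \sum_(i < n)
          (H *m e i w + G *m z i w) *m (H *m e i w + G *m z i w)^T) a b -
        (G *m G^T) a b| <= g w.
Proof.
move=> K0.
pose Hc x := m%:R * \sum_c H x c ^+ 2; pose Gc x := r%:R * \sum_j G x j ^+ 2.
have Hc0 x : 0 <= Hc x by rewrite mulr_ge0 // sumr_ge0 // => c _; exact: sqr_ge0.
have Gc0 x : 0 <= Gc x by rewrite mulr_ge0 // sumr_ge0 // => c _; exact: sqr_ge0.
pose GG := \sum_j \sum_l `|G a j * G b l|.
have GG0 : 0 <= GG by apply: sumr_ge0 => j _; apply: sumr_ge0.
(* Coefficient of [h s] in the mean of [f1] below: [s^-1] times drift mean squares of order [h^2],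
   plus [s] times noise mean squares of order [h]. *)
pose C1 := (Hc a + Hc b) * K + (Gc a + Gc b).
have C10 : 0 <= C1 by rewrite addr_ge0 // ?mulr_ge0 // addr_ge0.
(* The factor 3/2 is [mean_le_norm] at mean square [2 / n] with [t = sqrt n]. *)
exists (C1 + 3 / 2 * GG) => n h e z n0 /andP[h0 h1] me he gz.
set s := Num.sqrt h in gz *.
have s0 : 0 < s by rewrite sqrtr_gt0.
have s1 : s <= 1 by rewrite -sqrtr1 ler_sqrt.
have sh : s ^+ 2 = h by rewrite sqr_sqrtr // ltW.
set t := Num.sqrt n%:R; have n0' : 0 < n%:R :> R by rewrite ltr0n.
have t0 : 0 < t by rewrite sqrtr_gt0.
have tn : t ^+ 2 = n%:R by rewrite sqr_sqrtr // ltW.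
have nh0 : 0 < n%:R * h by rewrite mulr_gt0.
have mz i : random_vector (z i).
  by move=> j k; rewrite (ord1 k); exact: (gz.1 (i, j)).
pose u i w x : R := (H *m e i w) x 0; pose v i w x : R := (G *m z i w) x 0.
have hu i x : mean_le P (fun w => u i w x ^+ 2) (Hc x * (K * h ^+ 2)).
  by apply: mean_le_linear_sqr => // c; exact: he.
have hz i c : mean_le P (fun w => z i w c 0 ^+ 2) h.
  apply: has_integral_mean_le => [w|]; first exact: sqr_ge0.
  by rewrite -sh; exact: (gaussian_array_sqr_mean s0 gz (i, c)).
have hv i x : mean_le P (fun w => v i w x ^+ 2) (Gc x * h).
  by apply: mean_le_linear_sqr => // c; exact: hz.
pose f1 i w := s^-1 * (u i w a ^+ 2 + u i w b ^+ 2) +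
               s * (v i w a ^+ 2 + v i w b ^+ 2).
have si0 : 0 <= s^-1 by rewrite invr_ge0 ltW.
have hf1 i : mean_le P (f1 i) (C1 * (h * s)).
  apply: mean_le_weaken (mean_leD (mean_leZ si0 (mean_leD (hu i a) (hu i b)))
    (mean_leZ (ltW s0) (mean_leD (hv i a) (hv i b)))).
  by rewrite /C1 -sh le_eqVlt; apply/orP; left; apply/eqP; field; rewrite gt_eqF.
pose S j l w := (n%:R * h)^-1 *
  \sum_(i < n) (z i w j 0 * z i w l 0 - s ^+ 2 * (j == l)%:R).
have aK := @measurable_fun_algebra _ Omega R.
have mS j l : measurable_fun setT (S j l).
  apply: (fun_algebraZ aK); apply: (fun_algebra_sum aK) => i.
  apply: (fun_algebraB aK); last exact: (fun_algebra_cst aK).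
  by apply: (fun_algebraM aK); exact: mz.
have hS2 j l : mean_le P (fun w => S j l w ^+ 2) (2 / n%:R).
  have i0 : 0 <= (n%:R * h)^-1 ^+ 2 by exact: sqr_ge0.
  have := mean_leZ i0 (has_integral_mean_le (fun w => sqr_ge0 _)
    (gaussian_array_lln j l s0 gz)).
  rewrite (_ : (fun w => _) = (fun w => S j l w ^+ 2)); last first.
    by apply/funext => w; rewrite /S exprMn.
  apply: mean_le_weaken.
  have -> : (n%:R * h)^-1 ^+ 2 * (n%:R * (s ^+ 4 * (j == l).+1%:R)) =
      (j == l).+1%:R / n%:R :> R.
    by rewrite -sh; field; rewrite !gt_eqF.
  by rewrite ler_pM2r ?invr_gt0 // ler_nat; case: (j == l).
have hS j l : mean_le P (fun w => `|S j l w|) (3 / 2 * t^-1).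
  apply: mean_le_weaken (mean_le_norm t0 (mS j l) (hS2 j l)).
  by rewrite -tn le_eqVlt; apply/orP; left; apply/eqP; field; rewrite gt_eqF.
exists (fun w => (n%:R * h)^-1 * (\sum_i f1 i w) +
    \sum_j \sum_l `|G a j * G b l| * `|S j l w|).
  have nhi0 : 0 <= (n%:R * h)^-1 by rewrite invr_ge0 ltW.
  apply: mean_le_weaken (mean_leD (mean_leZ nhi0 (mean_le_sum _ hf1))
    (mean_le_sum _ (fun j => mean_le_sum _ (fun l =>
      mean_leZ (normr_ge0 (G a j * G b l)) (hS j l))))).
  under [X in _ + X <= _]eq_bigr do rewrite -mulr_suml.
  rewrite -!mulr_suml -/GG sumr_const card_ord -[C1 *+ n]mulr_natl.
  have -> : (n%:R * h)^-1 * (n%:R * C1 * (h * s)) = C1 * s.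
    by field; rewrite !gt_eqF.
  have ti0 : 0 <= t^-1 by rewrite invr_ge0 ltW.
  have x1 : 0 <= C1 * t^-1 by rewrite mulr_ge0.
  have x2 : 0 <= GG * s by rewrite mulr_ge0 // ltW.
  nra.
move=> w; rewrite !mxE summxE.
pose D i := (u i w a + v i w a) * (u i w b + v i w b) - v i w a * v i w b.
have e1 : \sum_(i < n) ((H *m e i w + G *m z i w) *m (H *m e i w + G *m z i w)^T) a b =
    \sum_i D i + \sum_i v i w a * v i w b.
  rewrite -big_split /=; apply: eq_bigr => i _.
  have eD x : (H *m e i w + G *m z i w) x 0 = u i w x + v i w x by rewrite mxE.
  by rewrite mxE big_ord1 [X in _ * X]mxE !eD /D subrK.
have e2 : \sum_i v i w a * v i w b =
    \sum_j \sum_l G a j * G b l * \sum_i z i w j 0 * z i w l 0.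
  under [RHS]eq_bigr do under eq_bigr do rewrite mulr_sumr.
  under [RHS]eq_bigr do rewrite exchange_big /=.
  rewrite [RHS]exchange_big /=; apply: eq_bigr => i _.
  rewrite /v !mxE big_distrlr /=; apply: eq_bigr => j _; apply: eq_bigr => l _.
  by ring.
have e3 : (n%:R * h)^-1 * \sum_i v i w a * v i w b - \sum_j G a j * G^T j b =
    \sum_j \sum_l G a j * G b l * S j l w.
  have -> : \sum_j G a j * G^T j b = \sum_j \sum_l G a j * G b l * (j == l)%:R.
    apply: eq_bigr => j _; rewrite (bigD1 j) //= eqxx mulr1 mxE big1 ?addr0 //.
    by move=> l; rewrite eq_sym => /negPf ->; rewrite mulr0.
  rewrite e2 mulr_sumr -sumrB; apply: eq_bigr => j _.
  rewrite mulr_sumr -sumrB; apply: eq_bigr => l _.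
  rewrite /S sumrB sumr_const card_ord -[_ *+ n]mulr_natl sh.
  by field; rewrite !gt_eqF.
rewrite e1 mulrDr -addrA e3; apply: (le_trans (ler_normD _ _)); apply: lerD.
  rewrite normrM gtr0_norm ?invr_gt0 //.
  apply: ler_wpM2l; first by rewrite invr_ge0 ltW.
  apply: (le_trans (ler_norm_sum _ _ _)); apply: ler_sum => i _.
  by apply: cross_term_le; rewrite s0.
apply: (le_trans (ler_norm_sum _ _ _)); apply: ler_sum => j _.
apply: (le_trans (ler_norm_sum _ _ _)); apply: ler_sum => l _.
by rewrite normrM.
Qed.

End RealizedCovariance.

(** * Mean square of the drift part *)

Section RiemannSums.
Context {R : realType}.
Implicit Types (f : R -> R) (a h s t : R).

Lemma step_index a t (n : nat) s : a <= s < a + n%:R * t ->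
  exists2 j, (j < n)%N & a + j%:R * t <= s < a + j.+1%:R * t.
Proof.
elim: n => [|n IH] /andP[h1 h2].
  by move: h2; rewrite mul0r addr0 ltNge h1.
have [h3|h3] := ltP s (a + n%:R * t).
  have [|j jn hj] := IH; first by rewrite h1.
  by exists j => //; exact: ltnW.
by exists n => //; rewrite h3.
Qed.

Lemma step_function_eq f a t n j s : 0 < t -> (j < n)%N ->
  a + j%:R * t <= s < a + j.+1%:R * t ->
  \sum_(l < n) f (a + l%:R * t) * \1_(`[a + l%:R * t, a + l.+1%:R * t[) s =
  f (a + j%:R * t).
Proof.
move=> t0 jn /andP[hj1 hj2]; rewrite (bigD1 (Ordinal jn)) //= indicE.
rewrite mem_set /= ?in_itv /= ?hj1 // mulr1 big1 ?addr0 // => l lj.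
rewrite indicE memNset ?mulr0 //= in_itv /= => /andP[h1 h2].
move: lj => /eqP; apply; apply: val_inj => /=; apply/eqP; rewrite eqn_leq.
have := le_lt_trans h1 hj2; rewrite ltrD2l ltr_pM2r // ltr_nat ltnS => ->.
by have := le_lt_trans hj1 h2; rewrite ltrD2l ltr_pM2r // ltr_nat ltnS => ->.
Qed.

Lemma within_continuous_dist f a b s e : {within `[a, b], continuous f} ->
  a <= s <= b -> 0 < e ->
  exists2 r, 0 < r & forall x, a <= x <= b -> `|s - x| < r -> `|f s - f x| < e.
Proof.
move=> /subspace_continuousP fc sab e0.
have /cvgrPdist_lt/(_ e e0) := fc s sab.
rewrite near_withinE => /nbhs_ballP[r r0 hr]; exists r => // x xab xr.
by apply: hr => //; rewrite /= in_itv.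
Qed.

(** Left Riemann sums are integrals of step functions, which converge pointwise by continuity and
    are dominated by a bound of [f] on the segment. *)
Lemma riemann_sum_cvg f a h : 0 < h -> {within `[a, a + h], continuous f} ->
  (h / k.+1%:R) * (\sum_(l < k.+1) f (a + l%:R * (h / k.+1%:R))) @[k --> \oo]
  --> (\int[lebesgue_measure]_(s in `[a, (a + h)%R]) f s)%R.
Proof.
move=> h0 fc; pose mu := @lebesgue_measure R.
pose t k : R := h / k.+1%:R; have t0 k : 0 < t k by rewrite divr_gt0.
have tN k : k.+1%:R * t k = h by rewrite /t mulrC divfK.
(* The half-open interval is partitioned exactly by the half-open steps; the endpoint it omits does
   not affect the integral. *)
pose D := `[a, (a + h)%R[%classic : set R.
pose step k s : R := \sum_(l < k.+1) f (a + l%:R * t k) *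
   \1_(`[a + l%:R * t k, a + l.+1%:R * t k[) s.
have istep k : has_integral mu (step k) (\sum_(l < k.+1) f (a + l%:R * t k) * t k).
  apply: has_integral_sum => l; apply: has_integralZ; split.
    exact: integrable_indic_itv.
  rewrite integral_indic // setIT [LHS]lebesgue_measure_itv /= lte_fin ltrD2l ltr_pM2r //.
  rewrite ltr_nat leqnn -EFinB; congr EFin.
  by rewrite -natr1; ring.
have step_out k s : ~ D s -> step k s = 0.
  move=> nD; apply: big1 => l _; rewrite indicE memNset ?mulr0 //= in_itv /= => /andP[h1 h2].
  apply: nD; rewrite /D /= in_itv /=; apply/andP; split.
    by apply: le_trans h1; rewrite lerDl mulr_ge0 // ltW.
  by apply: (lt_le_trans h2); rewrite lerD2l -(tN k) ler_pM2r // ler_nat.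
have iD k s : D s -> exists2 j, (j < k.+1)%N & a + j%:R * t k <= s < a + j.+1%:R * t k.
  rewrite /D /= in_itv /= => sD; apply: step_index; by rewrite tN.
have inD k j : (j < k.+1)%N -> a <= a + j%:R * t k <= a + h.
  move=> jk; have tk := ltW (t0 k); rewrite lerDl mulr_ge0 //= lerD2l -(tN k).
  by rewrite ler_pM2r // ler_nat ltnW.
have DD s : D s -> a <= s <= a + h by rewrite /D /= in_itv /= => /andP[-> /ltW].
have [B B0 hB] : exists2 B, 0 <= B & forall s, a <= s <= a + h -> `|f s| <= B.
  have /compact_bounded[B [_ hB]] := continuous_compact fc (@segment_compact _ a (a + h)).
  exists (`|B| + 1) => [|s sD]; first by rewrite addr_ge0.
  by apply: (hB (`|B| + 1)); [rewrite ltr_pwDr // ler_norm|exists s].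
have cvstep s : step k s @[k --> \oo] --> (f \_ D) s.
  rewrite patchE; case: ifPn => [/set_mem sD|/negP nD]; last first.
    have {}nD : ~ D s by move=> sD; apply: nD; rewrite inE.
    by under eq_fun do rewrite step_out //; exact: cvg_cst.
  apply/cvgrPdist_lt => e e0.
  have [r r0 hr] := within_continuous_dist fc (DD _ sD) e0.
  have : t k @[k --> \oo] --> 0.
    rewrite -[X in _ --> X](mulr0 h); apply: cvgM; first exact: cvg_cst.
    exact: cvg_harmonic.
  move=> /cvgrPdist_lt/(_ r r0); apply: filterS => k.
  rewrite sub0r normrN gtr0_norm // => tr.
  have [j jk hj] := iD k s sD; rewrite /step (step_function_eq f (t0 k) jk hj).
  apply: hr; first exact: inD.
  move: hj => /andP[h1 h2]; rewrite ger0_norm ?subr_ge0 //.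
  by apply: lt_trans tr; move: h2; rewrite -natr1 mulrDl mul1r; lra.
have iDI : mu.-integrable `[a, (a + h)%R] (EFin \o f).
  by apply: continuous_compact_integrable => //; exact: segment_compact.
have iDO : mu.-integrable D (EFin \o f).
  apply: (integrableS _ _ _ iDI).
  - exact: measurable_itv.
  - exact: measurable_itv.
  - by move=> s /DD; rewrite /= in_itv.
rewrite -Rintegral_itv_bndo_bndc // Rintegral_mkcond.
have [] := @dominated_convergence _ _ _ mu setT measurableT
   (fun k s => (step k s)%:E) (EFin \o (f \_ D)) (fun s => (B * \1_D s)%:E).
- move=> k; exact: measurable_int (istep k).1.
- rewrite -restrict_EFin; apply/(measurable_restrictT _ _).1; last exact: measurable_int iDO.
  exact: measurable_itv.
- apply: aeW => s _; apply: cvg_EFin; last exact: cvstep.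
  by apply: nearW.
- exact: (integrableZl measurableT B (integrable_indic_itv a (a + h) true true)).
- apply: aeW => s k _; rewrite lee_fin indicE.
  have [sD|nD] := pselect (D s); last by rewrite step_out // normr0 mulr_ge0.
  have [j jk hj] := iD k s sD; rewrite /step (step_function_eq f (t0 k) jk hj).
  by rewrite mem_set // mulr1; apply: hB; exact: inD.
move=> iI _; rewrite -(fineK (integrable_fin_num measurableT iI)) => /fine_cvg H.
rewrite /Rintegral; apply: cvg_trans H; apply: near_eq_cvg; apply: nearW => k /=.
by rewrite (istep k).2 /= -mulr_suml mulrC.
Qed.

End RiemannSums.

Lemma le_limn_einf (R : realType) (u v : (\bar R)^nat) :
  (forall n, (u n <= v n)%E) -> (limn_einf u <= limn_einf v)%E.
Proof.
move=> uv; rewrite !limn_einf_lim.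
apply: lee_lim; [exact: is_cvg_einfs|exact: is_cvg_einfs|].
apply: nearW => n; apply: le_ereal_inf_tmp => _ [k nk <-].
by apply: le_trans (uv k); apply: ereal_inf_lbound; exists k.
Qed.

(** * Mean square of a pathwise integral *)

Section MeanSquareIntegral.
Context {d : measure_display} {Omega : measurableType d} {R : realType}.
Variable P : probability Omega R.

(* Riemann sums and Fatou replace Cauchy-Schwarz and Tonelli, since the paths are
   continuous only almost surely and [X] need not be jointly measurable. *)
Lemma mean_le_integral_sqr (X G : R -> Omega -> R) (I : Omega -> R) (a h K : R) :
  0 < h ->
  (forall s, a <= s <= a + h -> measurable_fun setT (G s)) ->
  (forall s, a <= s <= a + h -> mean_le P (fun w => G s w ^+ 2) K) ->
  (forall s w, `|X s w| <= G s w) ->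
  measurable_fun setT I ->
  {ae P, forall w, {within `[a, (a + h)%R], continuous (X ^~ w)} /\
    I w = (\int[lebesgue_measure]_(s in `[a, (a + h)%R]) X s w)%R} ->
  mean_le P (fun w => I w ^+ 2) (K * h ^+ 2).
Proof.
move=> h0 mG hG XG mI XI.
pose t k : R := h / k.+1%:R; have t0 k : 0 < t k by rewrite divr_gt0.
have tN k : k.+1%:R * t k = h by rewrite /t mulrC divfK.
have inD k (l : 'I_k.+1) : a <= a + l%:R * t k <= a + h.
  have tk := ltW (t0 k); rewrite lerDl mulr_ge0 //= lerD2l -(tN k).
  by rewrite ler_pM2r // ler_nat ltnW.
(* Sums of the majorant [G] are measurable, and by [sqr_sum_le] their mean square is at most
   [(k+1)^2 (t k)^2 K], which is [K h^2]. *)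
pose S k w := t k * \sum_(l < k.+1) G (a + l%:R * t k) w.
have mS k : measurable_fun setT (S k).
  apply: measurable_funM => //.
  by apply: (fun_algebra_sum (@measurable_fun_algebra _ Omega R)) => l; exact: mG.
have hS k : mean_le P (fun w => S k w ^+ 2) (K * h ^+ 2).
  have := mean_leZ (c := t k ^+ 2 * k.+1%:R) _ (@mean_le_sum _ _ _ P _ (index_enum 'I_k.+1)
    (fun l w => G (a + l%:R * t k) w ^+ 2) (fun=> K) (fun l => hG _ (inD k l))).
  rewrite sumr_const card_ord => H.
  have {H} := H (mulr_ge0 (sqr_ge0 _) (ler0n _ _)).
  have -> : t k ^+ 2 * k.+1%:R * (K *+ k.+1) = K * h ^+ 2.
    by rewrite -(tN k) -mulr_natl; ring.
  apply: mean_le_dominated; first exact: measurable_funX.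
  move=> w; rewrite sqr_ge0 /= -mulrA exprMn ler_wpM2l ?sqr_ge0 //; exact: sqr_sum_le.
pose f k w : \bar R := (S k w ^+ 2)%:E.
have mf k : measurable_fun setT (f k) by apply/measurable_EFinP; case: (hS k).
have f0 k w : setT w -> (0 <= f k w)%E by move=> _; rewrite lee_fin sqr_ge0.
split; [exact: measurable_funX|by move=> w; exact: sqr_ge0|].
(* No continuity of [G] is available, so the sums [S k] may fail to converge; only their lower limit
   is used, bounded in mean by Fatou's lemma. *)
apply: (@le_trans _ _ (\int[P]_w limn_einf (f^~ w))%E); last first.
  apply: (le_trans (fatou P measurableT mf f0)).
  have [<- _] := cvg_limn_einf_sup (@cvg_cst _ (K * h ^+ 2)%:E _ (\oo : set_system nat) _).
  by apply: le_limn_einf => k; case: (hS k).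
apply: ae_ge0_le_integral => //.
- by move=> w _; rewrite lee_fin sqr_ge0.
- by apply/measurable_EFinP; exact: measurable_funX.
- move=> w _; have [<- _] := cvg_limn_einf_sup (@cvg_cst _ (0 : \bar R)%E _ (\oo : set_system nat) _).
  by apply: le_limn_einf => k; exact: f0.
- apply: measurableT_comp => //; apply: measurable_fun_limn_esup => k.
  exact: measurableT_comp.
(* On almost every path the Riemann sums of [X] do converge to [I], and their squares lie below
   those of [S k]. *)
apply: filterS XI => w [cX ->] _.
have H := riemann_sum_cvg h0 cX.
pose u k := h / k.+1%:R * \sum_(l < k.+1) X (a + l%:R * (h / k.+1%:R)) w.
have : (u k ^+ 2)%:E @[k --> \oo] -->
    ((\int[lebesgue_measure]_(s in `[a, (a + h)%R]) X s w)%R ^+ 2)%:E.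
  apply: cvg_EFin; first exact: nearW.
  by under eq_fun do rewrite /= expr2; rewrite expr2; apply: cvgM.
move=> /cvg_limn_einf_sup [<- _]; apply: le_limn_einf => k; rewrite lee_fin.
rewrite -[X in X <= _]real_normK ?num_real // ler_sqr ?nnegrE ?normr_ge0 //; last first.
  by apply: mulr_ge0; [exact: ltW|apply: sumr_ge0 => l _; exact: le_trans (XG _ w)].
rewrite normrM gtr0_norm; last exact: t0.
rewrite ler_wpM2l //; first exact: (ltW (t0 k)).
by apply: le_trans (ler_norm_sum _ _ _) _; apply: ler_sum.
Qed.

End MeanSquareIntegral.

Section DriftIncrement.
Context {d : measure_display} {Omega : measurableType d} {R : realType}.
Variable P : probability Omega R.

Lemma enorm_ge0 n (x : 'cV[R]_n) : 0 <= enorm x.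
Proof. exact: sqrtr_ge0. Qed.

Lemma measurable_enorm n (Y : Omega -> 'cV[R]_n) : random_vector Y ->
  measurable_fun setT (fun w => enorm (Y w)).
Proof.
move=> mY; have aK := @measurable_fun_algebra _ Omega R.
apply: measurableT_comp; first exact: (continuous_measurable_fun (@sqrt_continuous R)).
by apply: (fun_algebra_sum aK) => i; exact: (fun_algebraX aK).
Qed.

Lemma expr_1D_le (x : R) n : 0 <= x -> (1 + x) ^+ n <= 2 ^+ n * (1 + x ^+ n).
Proof.
move=> x0; have xn : 0 <= x ^+ n by exact: exprn_ge0.
have t0 : 0 <= 2 ^+ n :> R by exact: exprn_ge0.
have [x1|x1] := leP x 1.
  apply: (@le_trans _ _ (2 ^+ n)); first by rewrite lerXn2r ?nnegrE ?addr_ge0 //; lra.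
  by rewrite ler_peMr // lerDl.
apply: (@le_trans _ _ ((2 * x) ^+ n)).
  by rewrite lerXn2r ?nnegrE ?addr_ge0 ?mulr_ge0 //; lra.
by rewrite exprMn ler_wpM2l // lerDr.
Qed.

(** The majorant is an explicit function of the norm of [Y], hence measurable at each time, and the
    moment of order [2 m] bounds its mean square uniformly in time. *)
Lemma polynomial_growth_mean_sqr k (f : 'cV[R]_k -> R) (Y : R -> Omega -> 'cV[R]_k) :
  polynomial_growth f -> (forall t, 0 <= t -> random_vector (Y t)) ->
  bounded_moments P Y ->
  exists (G : R -> Omega -> R) (K : R), [/\ 0 <= K, forall s w, `|f (Y s w)| <= G s w,
    forall s, 0 <= s -> measurable_fun setT (G s) &
    forall s, 0 <= s -> mean_le P (fun w => G s w ^+ 2) K].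
Proof.
move=> [C [m hC]] mY hY; set N := (m * 2)%N.
have hsup := hY N%:R (ler0n _ _).
pose E (t : R) := ('E_P[(fun w => enorm (Y t w) `^ N%:R)%R])%E.
set M := ereal_sup _ in hsup.
have EM t : 0 <= t -> (E t <= M)%E.
  by move=> t0; apply: ereal_sup_ubound; exists t => //=; rewrite in_itv /= t0.
have E0 t : (0 <= E t)%E.
  by rewrite /E unlock; apply: integral_ge0 => w _; rewrite lee_fin powR_ge0.
have M0 : (0 <= M)%E by exact: le_trans (E0 0) (EM 0 (lexx _)).
have Mfin : M \is a fin_num by rewrite ge0_fin_numE.
have hE t : 0 <= t -> mean_le P (fun w => enorm (Y t w) ^+ N) (fine M).
  move=> t0; split.
  - by apply: measurable_funX; exact: measurable_enorm (mY t t0).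
  - by move=> w; apply: exprn_ge0; exact: enorm_ge0.
  - rewrite fineK //; apply: le_trans (EM t t0); rewrite /E unlock.
    by under [X in (_ <= X)%E]eq_integral do rewrite powR_mulrn ?enorm_ge0 //.
exists (fun s w => `|C| * (1 + enorm (Y s w)) ^+ m), (C ^+ 2 * (2 ^+ N * (1 + fine M))).
have C0 : 0 <= C ^+ 2 by exact: sqr_ge0.
have mG s : 0 <= s -> measurable_fun setT (fun w => `|C| * (1 + enorm (Y s w)) ^+ m).
  move=> s0; apply: measurable_funM => //; apply: measurable_funX.
  by apply: measurable_funD => //; exact: measurable_enorm (mY s s0).
split => //.
- by rewrite mulr_ge0 // mulr_ge0 ?exprn_ge0 // addr_ge0 // fine_ge0.
- move=> s w; apply: le_trans (hC _) _; rewrite ler_wpM2r ?ler_norm // exprn_ge0 //.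
  by rewrite addr_ge0 // enorm_ge0.
- move=> s s0.
  have t0 : 0 <= 2 ^+ N :> R by exact: exprn_ge0.
  have := mean_leZ C0 (mean_leZ t0 (mean_leD (mean_le_cst P (@ler01 R)) (hE s s0))).
  apply: mean_le_dominated; first exact: measurable_funX (mG s s0).
  move=> w; rewrite sqr_ge0 /= exprMn real_normK ?num_real // -exprM.
  by rewrite ler_wpM2l // expr_1D_le // enorm_ge0.
Qed.

Lemma sde_increment_integral k r (B : 'cV[R]_k -> 'cV[R]_k) (S : 'M[R]_(k, r))
    (W : R -> Omega -> 'cV[R]_r) c0 (Y : R -> Omega -> 'cV[R]_k) j a h w :
  continuous (fun x => B x j 0) -> 0 <= a -> 0 < h -> continuous_path (Y ^~ w) ->
  (forall t, 0 <= t -> Y t w = c0 +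
    \col_j (\int[lebesgue_measure]_(s in `[0%R, t]) (B (Y s w) j 0))%R + S *m W t w) ->
  {within `[a, (a + h)%R], continuous (fun s => B (Y s w) j 0)} /\
  (Y (a + h) w - Y a w - S *m (W (a + h) w - W a w)) j 0 =
    (\int[lebesgue_measure]_(s in `[a, (a + h)%R]) B (Y s w) j 0)%R.
Proof.
move=> cB a0 h0 cY eY; have ah0 : 0 <= a + h by rewrite addr_ge0 // ltW.
have cBY : {within `[0%R, +oo[, continuous (fun s => B (Y s w) j 0)}.
  by move=> s; exact: (@continuous_comp _ _ _ _ (fun x => B x j 0) s (cY s) (cB _)).
have sub u v : 0 <= u -> {within `[u, v], continuous (fun s => B (Y s w) j 0)}.
  move=> u0; apply: continuous_subspaceW cBY => s /=.
  by rewrite !in_itv /= => /andP[us _]; rewrite andbT (le_trans u0).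
split; first exact: sub.
have iBY u v : 0 <= u ->
    (@lebesgue_measure R).-integrable `[u, v] (EFin \o (fun s => B (Y s w) j 0)).
  by move=> u0; apply: continuous_compact_integrable; [exact: segment_compact|exact: sub].
rewrite -Rintegral_itv_obnd_cbnd; last first.
  apply: (integrableS _ _ _ (iBY a (a + h) a0)); [exact: measurable_itv..|].
  by move=> s; rewrite /= !in_itv /= => /andP[/ltW -> ->].
rewrite -(Rintegral_itvB (iBY 0 (a + h) (lexx _))) ?bnd_simp ?lerDl ?(ltW h0) //.
by rewrite (eY a a0) (eY (a + h) ah0) mulmxBr !mxE; ring.
Qed.

Lemma drift_increment_mean_sqr k r (B : 'cV[R]_k -> 'cV[R]_k) (S : 'M[R]_(k, r))
    (W : R -> Omega -> 'cV[R]_r) c0 (Y : R -> Omega -> 'cV[R]_k) :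
  (forall t, 0 <= t -> random_vector (W t)) ->
  sde_solution P B S W c0 Y -> regular_drift B -> bounded_moments P Y ->
  exists2 K, 0 <= K & forall a h j, 0 <= a -> 0 < h ->
    mean_le P (fun w => (Y (a + h) w - Y a w - S *m (W (a + h) w - W a w)) j 0 ^+ 2)
      (K * h ^+ 2).
Proof.
move=> mW [mY eY] [_ rB] hY; have aK := @measurable_fun_algebra _ Omega R.
have hK j : {K | 0 <= K & forall a h, 0 <= a -> 0 < h ->
    mean_le P (fun w => (Y (a + h) w - Y a w - S *m (W (a + h) w - W a w)) j 0 ^+ 2)
      (K * h ^+ 2)}.
  apply: cid2; have [cB pB] := rB j.
  (* The empty list of derivatives selects the growth bound on the drift itself. *)
  have [G [K [K0 hG mG eG]]] := polynomial_growth_mean_sqr (pB [::] isT) mY hY.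
  exists K => // a h a0 h0.
  have pos s : a <= s <= a + h -> 0 <= s by move=> /andP[/(le_trans a0)].
  have ah0 : 0 <= a + h by rewrite addr_ge0 // ltW.
  apply: (mean_le_integral_sqr (X := fun s w => B (Y s w) j 0) (G := G) (a := a)) => //.
  - by move=> s /pos; exact: mG.
  - by move=> s /pos; exact: eG.
  - move: j {K G cB pB hG mG eG K0} => j.
    apply: (entrywise_sub aK (entrywise_sub aK (mY _ ah0) (mY _ a0))).
    apply: (entrywise_mul aK); first exact: entrywise_cst.
    exact: (entrywise_sub aK (mW _ ah0) (mW _ a0)).
  - apply: filterS eY => w [cY eY]; apply: sde_increment_integral eY => //.
    exact: (cB [::] isT).1.
pose Kj j := s2val (hK j).
have Kj0 j : 0 <= Kj j by rewrite /Kj; case: (hK j).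
exists (\sum_j Kj j) => [|a h j a0 h0]; first exact: sumr_ge0.
have : mean_le P (fun w => (Y (a + h) w - Y a w - S *m (W (a + h) w - W a w)) j 0 ^+ 2)
      (Kj j * h ^+ 2) by rewrite /Kj; case: (hK j) => K /= _; apply.
apply: mean_le_weaken; rewrite ler_wpM2r ?sqr_ge0 // (bigD1 j) //= lerDl.
exact: sumr_ge0.
Qed.

End DriftIncrement.

(** * The observed process *)

Section WienerIncrements.
Context {d : measure_display} {Omega : measurableType d} {R : realType}.
Variable P : probability Omega R.

(** [independent4] speaks of events generated by the values of the processes; this brings increment
    events within its reach. *)
Lemma sigma_process_increments r (W : R -> Omega -> 'cV[R]_r) m (t : nat -> R)
    (A : 'I_m -> 'I_r -> set R) : (forall i, 0 <= t i) ->
  (forall i j, measurable (A i j)) ->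
  sigma_process W [set w | forall (i : 'I_m) (j : 'I_r),
                       A i j (W (t i.+1) w j 0 - W (t i) w j 0)].
Proof.
move=> t0 mA.
pose G := [set E | exists t j (A : set R),
  [/\ 0 <= t, measurable A & E = (fun w => W t w j 0) @^-1` A]].
pose T := g_sigma_algebraType G.
have mW s j : 0 <= s -> measurable_fun setT (fun w : T => W s w j 0).
  by move=> s0 _ B mB; rewrite setTI; apply: sub_sigma_algebra; exists s, j, B.
suff : measurable ([set w | forall (i : 'I_m) (j : 'I_r),
    A i j (W (t i.+1) w j 0 - W (t i) w j 0)] : set T) by [].
have -> : [set w | forall (i : 'I_m) (j : 'I_r),
    A i j (W (t i.+1) w j 0 - W (t i) w j 0)] =
  \bigcap_(i in [set: 'I_m]) \bigcap_(j in [set: 'I_r])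
    ((fun w : T => W (t i.+1) w j 0 - W (t i) w j 0) @^-1` A i j).
  by apply/seteqP; split => w H i => [_ j _|j]; [exact: H|exact: H i I j I].
apply: fin_bigcap_measurable => // i _; apply: fin_bigcap_measurable => // j _.
rewrite -[X in measurable X]setTI; apply: measurable_funB => //; exact: mW.
Qed.

Context {r1 r2 r3 r4 : nat}.
Variables (W1 : R -> Omega -> 'cV[R]_r1) (W2 : R -> Omega -> 'cV[R]_r2)
  (W3 : R -> Omega -> 'cV[R]_r3) (W4 : R -> Omega -> 'cV[R]_r4).

Definition stacked_increment (h : R) (i : nat) (w : Omega) :
    'cV[R]_((r1 + r2) + (r3 + r4)) :=
  col_mx (col_mx (W1 (i.+1%:R * h) w - W1 (i%:R * h) w)
                 (W2 (i.+1%:R * h) w - W2 (i%:R * h) w))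
         (col_mx (W3 (i.+1%:R * h) w - W3 (i%:R * h) w)
                 (W4 (i.+1%:R * h) w - W4 (i%:R * h) w)).

Hypotheses (hW1 : standard_wiener P W1) (hW2 : standard_wiener P W2)
  (hW3 : standard_wiener P W3) (hW4 : standard_wiener P W4)
  (hW : independent4 P W1 W2 W3 W4).

Lemma wiener_increment_law r (W : R -> Omega -> 'cV[R]_r) n (h : R)
    (A : 'I_n -> 'I_r -> set R) :
  standard_wiener P W -> 0 < h -> (forall i j, measurable (A i j)) ->
  P [set w | forall (i : 'I_n) (j : 'I_r),
       A i j (W (i.+1%:R * h) w j 0 - W (i%:R * h) w j 0)] =
  (\prod_(i < n) \prod_(j < r) normal_prob 0%R (Num.sqrt h) (A i j))%E.
Proof.
move=> [_ _ law] h0 mA; pose t i : R := i%:R * h.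
have t0 : 0 <= t 0%N by rewrite /t mul0r.
have tS i : (i < n)%N -> t i < t i.+1 by rewrite ltr_pM2r // ltr_nat.
apply: (etrans (law n t t0 tS A mA)).
apply: eq_bigr => i _; apply: eq_bigr => j _.
have th : t i.+1 - t i = h by rewrite /t -mulrBl -natrB ?leqnSn // subSnn mul1r.
by rewrite th.
Qed.

Lemma random_vector_stacked_increment h i : 0 < h ->
  random_vector (stacked_increment h i).
Proof.
move=> h0; have aK := @measurable_fun_algebra _ Omega R.
have t0 k : 0 <= k%:R * h by rewrite mulr_ge0 // ltW.
have inc r (W : R -> Omega -> 'cV[R]_r) : standard_wiener P W ->
    random_vector (fun w => W (i.+1%:R * h) w - W (i%:R * h) w).
  by move=> [mW _ _]; apply: (entrywise_sub aK); exact: mW.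
by apply: entrywise_col; apply: entrywise_col; exact: inc.
Qed.

(** A rectangle event for the stacked vector is the intersection of one event per Wiener process.
    Independence splits its probability, and the four products regroup over the stacked index. *)
Lemma gaussian_array_stacked_increment n (h : R) : 0 < h ->
  gaussian_array P (Num.sqrt h)
    (fun ij : 'I_n * 'I_((r1 + r2) + (r3 + r4)) =>
      fun w => stacked_increment h ij.1 w ij.2 0).
Proof.
move=> h0; split=> [[i j]|A mA]; first exact: random_vector_stacked_increment.
pose E r (W : R -> Omega -> 'cV[R]_r) (f : 'I_r -> 'I_((r1 + r2) + (r3 + r4))) :=
  [set w | forall (i : 'I_n) (j : 'I_r),
     A (i, f j) (W (i.+1%:R * h) w j 0 - W (i%:R * h) w j 0)].
have t0 k : 0 <= k%:R * h by rewrite mulr_ge0 // ltW.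
have -> : [set w | forall k, A k (stacked_increment h k.1 w k.2 0)] =
    E _ W1 (lshift _ \o lshift _) `&` E _ W2 (lshift _ \o @rshift _ _) `&`
    E _ W3 (@rshift _ _ \o lshift _) `&` E _ W4 (@rshift _ _ \o @rshift _ _).
  apply/seteqP; split => w /=.
    move=> H; split; first split; first split.
    - by move=> i j; have := H (i, lshift _ (lshift _ j)); rewrite !col_mxEu !mxE.
    - by move=> i j; have := H (i, lshift _ (rshift _ j)); rewrite col_mxEu col_mxEd !mxE.
    - by move=> i j; have := H (i, rshift _ (lshift _ j)); rewrite col_mxEd col_mxEu !mxE.
    - by move=> i j; have := H (i, rshift _ (rshift _ j)); rewrite !col_mxEd !mxE.
  move=> [[[H1 H2] H3] H4] [i j] /=; rewrite /stacked_increment.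
  case: (split_ordP j) => j' ->; case: (split_ordP j') => j'' ->;
    rewrite ?(col_mxEu, col_mxEd) !mxE;
    [exact: H1|exact: H2|exact: H3|exact: H4].
have sE r (W : R -> Omega -> 'cV[R]_r) f : sigma_process W (E r W f).
  exact: (@sigma_process_increments r W n (fun i => i%:R * h)
    (fun i j => A (i, f j)) t0 (fun i j => mA _)).
rewrite hW //.
have law r (W : R -> Omega -> 'cV[R]_r) f : standard_wiener P W -> P (E r W f) =
    (\prod_(i < n) \prod_(j < r) normal_prob 0%R (Num.sqrt h) (A (i, f j)))%E.
  by move=> sW; apply: (wiener_increment_law (A := fun i j => A (i, f j)) sW h0).
have -> : (\prod_k normal_prob 0%R (Num.sqrt h) (A k) =
    \prod_i \prod_j normal_prob 0%R (Num.sqrt h) (A (i, j)))%E.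
  by rewrite pair_bigA; apply: eq_bigr => -[i j].
rewrite !law //.
rewrite -!big_split /=; apply: eq_bigr => i _.
by rewrite !big_split_ord /= muleA.
Qed.

End WienerIncrements.

(** * The observation as a linear image of the stacked latent processes *)

Section StackedModel.
Context {R : realType} {p1 p2 k1 k2 : nat}.
Implicit Types s : sem R p1 p2 k1 k2.

Definition stacked_load s : 'M[R]_(p1 + p2, (k1 + p1) + (p2 + k2)) :=
  row_mx (row_mx (load_xi s) (load_delta)) (row_mx (load_eps) (load_zeta s)).

(** Diffusion matrix of the observation with respect to the stacked Wiener process: the [G] of the
    overview. *)
Definition noise_load s r1 r2 r3 r4 (S1 : 'M[R]_(k1, r1)) (S2 : 'M[R]_(p1, r2))
    (S3 : 'M[R]_(p2, r3)) (S4 : 'M[R]_(k2, r4)) :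
    'M[R]_(p1 + p2, (r1 + r2) + (r3 + r4)) :=
  row_mx (row_mx (load_xi s *m S1) (load_delta *m S2))
         (row_mx (load_eps *m S3) (load_zeta s *m S4)).

Lemma Sigma_noise_load s r1 r2 r3 r4 (S1 : 'M[R]_(k1, r1)) (S2 : 'M[R]_(p1, r2))
    (S3 : 'M[R]_(p2, r3)) (S4 : 'M[R]_(k2, r4)) :
  Sxi s = S1 *m S1^T -> Sdelta s = S2 *m S2^T -> Seps s = S3 *m S3^T ->
  Szeta s = S4 *m S4^T ->
  Sigma s = noise_load s S1 S2 S3 S4 *m (noise_load s S1 S2 S3 S4)^T.
Proof.
move=> e1 e2 e3 e4; rewrite SigmaE; last by rewrite e1 trmx_mul trmxK.
rewrite e1 e2 e3 e4 /noise_load !tr_row_mx !mul_row_col !trmx_mul !mulmxA.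
by [].
Qed.

(** The equation for [eta] is implicit; invertibility of [Psi s] turns it into
    [eta = invmx (Psi s) *m (Gam s *m x + z)]. *)
Lemma observation_stacked_load s (x : 'cV[R]_k1) (de : 'cV[R]_p1) (ep : 'cV[R]_p2)
    (z eta : 'cV[R]_k2) : Psi s \in unitmx ->
  eta = (1%:M - Psi s) *m eta + Gam s *m x + z ->
  col_mx (Lx1 s *m x + de) (Lx2 s *m eta + ep) =
  stacked_load s *m col_mx (col_mx x de) (col_mx ep z).
Proof.
move=> uP h; have -> : eta = invmx (Psi s) *m (Gam s *m x + z).
  apply: (canRL (mulKmx uP)); apply: (addrI (eta - Psi s *m eta)).
  by move: h; rewrite mulmxBl mul1mx subrK addrA.
rewrite /stacked_load !mul_row_col /load_xi /load_delta /load_eps /load_zeta.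
rewrite !mul_col_mx !mul1mx !mul0mx !add_col_mx !addr0.
by congr col_mx; rewrite !mulmxDr !mulmxA -addrA [X in _ + X]addrC.
Qed.

Lemma stacked_load_split s r1 r2 r3 r4 (S1 : 'M[R]_(k1, r1)) (S2 : 'M[R]_(p1, r2))
    (S3 : 'M[R]_(p2, r3)) (S4 : 'M[R]_(k2, r4)) (v1 : 'cV_k1) (v2 : 'cV_p1)
    (v3 : 'cV_p2) (v4 : 'cV_k2) (u1 : 'cV_r1) (u2 : 'cV_r2) (u3 : 'cV_r3) (u4 : 'cV_r4) :
  stacked_load s *m col_mx (col_mx v1 v2) (col_mx v3 v4) =
  stacked_load s *m col_mx (col_mx (v1 - S1 *m u1) (v2 - S2 *m u2))
                           (col_mx (v3 - S3 *m u3) (v4 - S4 *m u4)) +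
  noise_load s S1 S2 S3 S4 *m col_mx (col_mx u1 u2) (col_mx u3 u4).
Proof.
have split m k r (L : 'M[R]_(m, k)) (S : 'M[R]_(k, r)) v (u : 'cV_r) :
  L *m v = L *m (v - S *m u) + L *m S *m u by rewrite -mulmxA -mulmxDr subrK.
rewrite /stacked_load /noise_load !mul_row_col.
rewrite (split _ _ _ _ S1 v1 u1) (split _ _ _ _ S2 v2 u2).
rewrite (split _ _ _ _ S3 v3 u3) (split _ _ _ _ S4 v4 u4).
rewrite [LHS](congr2 +%R (addrACA _ _ _ _) (addrACA _ _ _ _)); exact: addrACA.
Qed.

End StackedModel.

Section RealizedCovarianceError.
Context {d : measure_display} {Omega : measurableType d} {R : realType}.
Variable P : probability Omega R.
Context {p1 p2 k1 k2 r1 r2 r3 r4 : nat}.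
Variables (W1 : R -> Omega -> 'cV[R]_r1) (W2 : R -> Omega -> 'cV[R]_r2)
  (W3 : R -> Omega -> 'cV[R]_r3) (W4 : R -> Omega -> 'cV[R]_r4).
Hypotheses (hW1 : standard_wiener P W1) (hW2 : standard_wiener P W2)
  (hW3 : standard_wiener P W3) (hW4 : standard_wiener P W4)
  (hW : independent4 P W1 W2 W3 W4).
Variables (B1 : 'cV[R]_k1 -> 'cV[R]_k1) (B2 : 'cV[R]_p1 -> 'cV[R]_p1)
  (B3 : 'cV[R]_p2 -> 'cV[R]_p2) (B4 : 'cV[R]_k2 -> 'cV[R]_k2)
  (S1 : 'M[R]_(k1, r1)) (S2 : 'M[R]_(p1, r2))
  (S3 : 'M[R]_(p2, r3)) (S4 : 'M[R]_(k2, r4))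
  (c1 : 'cV[R]_k1) (c2 : 'cV[R]_p1) (c3 : 'cV[R]_p2) (c4 : 'cV[R]_k2)
  (xi0 : R -> Omega -> 'cV[R]_k1) (delta0 : R -> Omega -> 'cV[R]_p1)
  (eps0 : R -> Omega -> 'cV[R]_p2) (zeta0 : R -> Omega -> 'cV[R]_k2).
Hypotheses (hxi : sde_solution P B1 S1 W1 c1 xi0)
  (hdelta : sde_solution P B2 S2 W2 c2 delta0)
  (heps : sde_solution P B3 S3 W3 c3 eps0)
  (hzeta : sde_solution P B4 S4 W4 c4 zeta0).
Hypotheses (hB1 : regular_drift B1) (hB2 : regular_drift B2)
  (hB3 : regular_drift B3) (hB4 : regular_drift B4).
Hypotheses (hm1 : bounded_moments P xi0) (hm2 : bounded_moments P delta0)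
  (hm3 : bounded_moments P eps0) (hm4 : bounded_moments P zeta0).
Variables (s : sem R p1 p2 k1 k2) (X : R -> Omega -> 'cV[R]_(p1 + p2)).
Hypotheses (e1 : Sxi s = S1 *m S1^T) (e2 : Sdelta s = S2 *m S2^T)
  (e3 : Seps s = S3 *m S3^T) (e4 : Szeta s = S4 *m S4^T).
Hypothesis hX : forall t w, 0 <= t -> X t w = stacked_load s *m
  col_mx (col_mx (xi0 t w) (delta0 t w)) (col_mx (eps0 t w) (zeta0 t w)).

Let aK := @measurable_fun_algebra _ Omega R.

Lemma random_vector_observation t : 0 <= t -> random_vector (X t).
Proof.
move=> t0; have -> : X t = fun w => stacked_load s *m
  col_mx (col_mx (xi0 t w) (delta0 t w)) (col_mx (eps0 t w) (zeta0 t w)).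
  by apply/funext => w; exact: hX.
apply: (entrywise_mul aK); first exact: entrywise_cst.
apply: entrywise_col; apply: entrywise_col.
- exact: hxi.1.
- exact: hdelta.1.
- exact: heps.1.
- exact: hzeta.1.
Qed.

Lemma random_vector_realized_cov (h : R) n : 0 <= h ->
  random_vector (fun w => realized_cov h n (X ^~ w)).
Proof.
move=> h0; have mX k : random_vector (X (k%:R * h)).
  by apply: random_vector_observation; exact: mulr_ge0.
apply: (entrywise_scale aK); apply: (entrywise_sum aK) => i.
have mD := entrywise_sub aK (mX i.+1) (mX i).
exact: (entrywise_mul aK mD (entrywise_tr mD)).
Qed.

(** For an SDE solution this is almost surely the drift integrated over one step. Written as a
    difference, it is measurable without any appeal to the integral. *)
Definition drift_increment k r (S : 'M[R]_(k, r)) (W : R -> Omega -> 'cV[R]_r)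
    (Y : R -> Omega -> 'cV[R]_k) (h : R) (i : nat) (w : Omega) : 'cV[R]_k :=
  Y (i.+1%:R * h) w - Y (i%:R * h) w - S *m (W (i.+1%:R * h) w - W (i%:R * h) w).

Lemma drift_increment_sde k r (S : 'M[R]_(k, r)) (W : R -> Omega -> 'cV[R]_r)
    (B : 'cV[R]_k -> 'cV[R]_k) c (Y : R -> Omega -> 'cV[R]_k) :
  standard_wiener P W -> sde_solution P B S W c Y -> regular_drift B ->
  bounded_moments P Y ->
  exists2 K, 0 <= K & forall h i, 0 < h ->
    random_vector (drift_increment S W Y h i) /\
    forall j, mean_le P (fun w => drift_increment S W Y h i w j 0 ^+ 2) (K * h ^+ 2).
Proof.
move=> [mW _ _] sY rB mY; have [K K0 hK] := drift_increment_mean_sqr mW sY rB mY.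
exists K => // h i h0; have t0 k' : 0 <= k'%:R * h by rewrite mulr_ge0 // ltW.
split.
  apply: (entrywise_sub aK); first by apply: (entrywise_sub aK); exact: sY.1.
  apply: (entrywise_mul aK); first exact: entrywise_cst.
  by apply: (entrywise_sub aK); exact: mW.
move=> j; have := hK (i%:R * h) h j (t0 i) h0.
have -> : i%:R * h + h = i.+1%:R * h by rewrite -natr1 mulrDl mul1r.
by [].
Qed.

(** Each increment of [X] splits into drift and noise by [stacked_load_split]. Summing the entrywise
    bounds over all positions yields one constant and one random majorant [g] for the whole
    matrix. *)
Lemma realized_cov_mean_le : exists C, forall n (h : R), (0 < n)%N -> 0 < h <= 1 ->
  exists2 g, mean_le P g (C * ((Num.sqrt n%:R)^-1 + Num.sqrt h)) &
    forall w a b, `|realized_cov h n (X ^~ w) a b - Sigma s a b| <= g w.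
Proof.
have [K1 K10 hK1] := drift_increment_sde hW1 hxi hB1 hm1.
have [K2 K20 hK2] := drift_increment_sde hW2 hdelta hB2 hm2.
have [K3 K30 hK3] := drift_increment_sde hW3 heps hB3 hm3.
have [K4 K40 hK4] := drift_increment_sde hW4 hzeta hB4 hm4.
pose K := K1 + K2 + K3 + K4.
have K0 : 0 <= K by rewrite !addr_ge0.
pose H := stacked_load s; pose G := noise_load s S1 S2 S3 S4.
have hab a b := cid (realized_cov_mean_error P H G a b K0).
pose C a b := sval (hab a b).
exists (\sum_a \sum_b C a b) => n h n0 hh; have /andP[h0 h1] := hh.
pose e (i : 'I_n) w := col_mx
  (col_mx (drift_increment S1 W1 xi0 h i w) (drift_increment S2 W2 delta0 h i w))
  (col_mx (drift_increment S3 W3 eps0 h i w) (drift_increment S4 W4 zeta0 h i w)).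
pose z (i : 'I_n) := stacked_increment W1 W2 W3 W4 h i.
have me i : random_vector (e i).
  by apply: entrywise_col; apply: entrywise_col;
    [case: (hK1 h i h0)|case: (hK2 h i h0)|case: (hK3 h i h0)|case: (hK4 h i h0)].
have hh2 : 0 <= h ^+ 2 by exact: sqr_ge0.
have he i c : mean_le P (fun w => e i w c 0 ^+ 2) (K * h ^+ 2).
  rewrite /e; case: (split_ordP c) => c' ->; case: (split_ordP c') => c'' ->.
  - under eq_fun do rewrite !col_mxEu.
    apply: mean_le_weaken ((hK1 h i h0).2 c''); rewrite ler_wpM2r // /K; lra.
  - under eq_fun do rewrite col_mxEu col_mxEd.
    apply: mean_le_weaken ((hK2 h i h0).2 c''); rewrite ler_wpM2r // /K; lra.
  - under eq_fun do rewrite col_mxEd col_mxEu.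
    apply: mean_le_weaken ((hK3 h i h0).2 c''); rewrite ler_wpM2r // /K; lra.
  - under eq_fun do rewrite !col_mxEd.
    apply: mean_le_weaken ((hK4 h i h0).2 c''); rewrite ler_wpM2r // /K; lra.
have gz := gaussian_array_stacked_increment hW1 hW2 hW3 hW4 hW n h0.
have hg a b := cid2 (svalP (hab a b) n h e z n0 hh me he gz).
pose g a b := s2val (hg a b).
have mg a b : mean_le P (g a b) (C a b * ((Num.sqrt n%:R)^-1 + Num.sqrt h)).
  exact: s2valP (hg a b).
have incX (i : 'I_n) w : X (i.+1%:R * h) w - X (i%:R * h) w = H *m e i w + G *m z i w.
  have t0 k : 0 <= k%:R * h by rewrite mulr_ge0 // ltW.
  rewrite !hX // -mulmxBr !opp_col_mx !add_col_mx.
  exact: stacked_load_split.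
exists (fun w => \sum_a \sum_b g a b w) => [|w a b].
  rewrite mulr_suml; apply: mean_le_sum => a.
  by rewrite mulr_suml; apply: mean_le_sum => b; exact: mg.
have g0 a' b' : 0 <= g a' b' w by case: (mg a' b').
have gle : g a b w <= \sum_a \sum_b g a b w.
  rewrite (bigD1 a) //= (bigD1 b) //= -addrA lerDl addr_ge0 ?sumr_ge0 //.
  by move=> a' _; exact: sumr_ge0.
apply: le_trans gle; have := s2valP' (hg a b) w; rewrite -/(g a b).
rewrite (Sigma_noise_load e1 e2 e3 e4) -/G /realized_cov.
by under [in X in _ -> X]eq_bigr do rewrite incX.
Qed.

End RealizedCovarianceError.

(** * Consistency of the test *)

(** Off [E n] the majorant [g] is at least [e], so Markov's inequality bounds the probability of the
    complement by [C * r n / e]. *)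
Lemma probability_cvg1 (d : measure_display) (Omega : measurableType d)
    (R : realType) (P : probability Omega R) (E : nat -> set Omega) (C e : R)
    (r : nat -> R) :
  (forall n, measurable (E n)) -> 0 < e -> r n @[n --> \oo] --> 0 ->
  (\forall n \near \oo, exists2 g, mean_le P g (C * r n) &
    forall w, g w < e -> E n w) ->
  P (E n) @[n --> \oo] --> 1%E.
Proof.
move=> mE e0 r0 hE.
apply: (@squeeze_cvge _ _ _ _ (fun n => (1 - (C * r n / e)%:E)%E) _ (fun=> 1%E)).
- apply: filterS hE => n [g mg hg]; rewrite probability_le1 ?andbT //.
  have PE : P (~` E n) = (1 - P (E n))%E by rewrite probability_setC.
  have hC : (P (~` E n) <= (C * r n / e)%:E)%E.
    apply: le_trans (markov_mean_le e0 mg); apply: le_measure; rewrite ?inE.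
    - exact: measurableC.
    - rewrite -[X in measurable X]setTI; have [mgf _ _] := mg.
      exact: (measurable_fun_ler (measurable_cst e) mgf).
    - by move=> w nE /=; rewrite leNgt; apply/negP => /hg.
  have Pfin : P (E n) \is a fin_num by exact: fin_num_measure.
  move: hC; rewrite PE -(fineK Pfin) -!EFinB !lee_fin; lra.
- rewrite [X in _ --> X](_ : _ = (1 - (C * 0 / e)%:E)%E); last first.
    by rewrite mulr0 mul0r sube0.
  apply: cvgeB => //; first exact: cvg_cst.
  apply: cvg_EFin; first exact: nearW.
  by apply: cvgMl; apply: cvgMr.
- exact: cvg_cst.
Qed.

Lemma rate_cvg0 (R : realType) (h : nat -> R) : h n @[n --> \oo] --> 0 ->
  (Num.sqrt n%:R)^-1 + Num.sqrt (h n) @[n --> \oo] --> 0.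
Proof.
move=> h0; rewrite -[X in _ --> X]addr0.
have sq (u : nat -> R) : u n @[n --> \oo] --> 0 -> Num.sqrt (u n) @[n --> \oo] --> 0.
  move=> u0; rewrite -[X in _ --> X](@sqrtr0 R).
  exact: (continuous_cvg _ (@sqrt_continuous R 0)).
apply: cvgD; last exact: sq.
under eq_fun do rewrite -sqrtrV //.
by apply: sq; rewrite -(cvg_shiftS (fun n => n%:R^-1 : R)); exact: cvg_harmonic.
Qed.

Unset Implicit Arguments.

Theorem theorem12 (R : realType) (d : measure_display)
    (Omega : measurableType d) (P : probability Omega R)
    (p1 p2 k1 k2 r1 r2 r3 r4 q : nat)
    (hp1 : (0 < p1)%N) (hp2 : (0 < p2)%N)
    (hk1 : (0 < k1 <= p1)%N) (hk2 : (0 < k2 <= p2)%N)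
    (hr1 : (0 < r1)%N) (hr2 : (0 < r2)%N) (hr3 : (0 < r3)%N) (hr4 : (0 < r4)%N)
    (* driving noise *)
    (W1 : R -> Omega -> 'cV[R]_r1) (W2 : R -> Omega -> 'cV[R]_r2)
    (W3 : R -> Omega -> 'cV[R]_r3) (W4 : R -> Omega -> 'cV[R]_r4)
    (hW1 : standard_wiener P W1) (hW2 : standard_wiener P W2)
    (hW3 : standard_wiener P W3) (hW4 : standard_wiener P W4)
    (hW : independent4 P W1 W2 W3 W4)
    (* latent processes *)
    (B1 : 'cV[R]_k1 -> 'cV[R]_k1) (B2 : 'cV[R]_p1 -> 'cV[R]_p1)
    (B3 : 'cV[R]_p2 -> 'cV[R]_p2) (B4 : 'cV[R]_k2 -> 'cV[R]_k2)
    (S1 : 'M[R]_(k1, r1)) (S2 : 'M[R]_(p1, r2))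
    (S3 : 'M[R]_(p2, r3)) (S4 : 'M[R]_(k2, r4))
    (c1 : 'cV[R]_k1) (c2 : 'cV[R]_p1) (c3 : 'cV[R]_p2) (c4 : 'cV[R]_k2)
    (xi0 : R -> Omega -> 'cV[R]_k1) (delta0 : R -> Omega -> 'cV[R]_p1)
    (eps0 : R -> Omega -> 'cV[R]_p2) (zeta0 : R -> Omega -> 'cV[R]_k2)
    (hxi : sde_solution P B1 S1 W1 c1 xi0)
    (hdelta0 : sde_solution P B2 S2 W2 c2 delta0)
    (heps : sde_solution P B3 S3 W3 c3 eps0)
    (hzeta : sde_solution P B4 S4 W4 c4 zeta0)
    (hB1 : regular_drift B1) (hB2 : regular_drift B2)
    (hB3 : regular_drift B3) (hB4 : regular_drift B4)
    (hm1 : bounded_moments P xi0) (hm2 : bounded_moments P delta0)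
    (hm3 : bounded_moments P eps0) (hm4 : bounded_moments P zeta0)
    (he1 : ergodic P B1 S1 W1 xi0) (he2 : ergodic P B2 S2 W2 delta0)
    (he3 : ergodic P B3 S3 W3 eps0) (he4 : ergodic P B4 S4 W4 zeta0)
    (* true matrices and observed process *)
    (L10 : 'M[R]_(p1, k1)) (L20 : 'M[R]_(p2, k2))
    (G0 : 'M[R]_(k2, k1)) (B0 : 'M[R]_k2)
    (true_sem : sem R p1 p2 k1 k2)
    (htrue : true_sem = Sem L10 L20 G0 (1%:M - B0)
       (S1 *m S1^T) (S2 *m S2^T) (S3 *m S3^T) (S4 *m S4^T))
    (hadm0 : sem_admissible true_sem)
    (eta0 : R -> Omega -> 'cV[R]_k2)
    (heta : forall t w, 0 <= t ->
       eta0 t w = B0 *m eta0 t w + G0 *m xi0 t w + zeta0 t w)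
    (X : R -> Omega -> 'cV[R]_(p1 + p2))
    (hX : forall t w, 0 <= t ->
       X t w = col_mx (L10 *m xi0 t w + delta0 t w)
                      (L20 *m eta0 t w + eps0 t w))
    (* parametric model *)
    (Theta : set 'rV[R]_q) (hconv : convex_set Theta) (hcomp : compact Theta)
    (M : sem_template R p1 p2 k1 k2 q) (hM : template_wf M)
    (hadm : forall theta, Theta theta -> sem_admissible (sem_at M theta))
    (* tuning constants *)
    (h l1 l2 : nat -> R) (gamma delta alpha : R)
    (hh : forall n, 0 < h n) (hl1 : forall n, 0 < l1 n)
    (hl2 : forall n, 0 < l2 n) (hgamma : 0 < gamma) (hdelta : 0 < delta)
    (halpha : 0 < alpha < 1)
    (* estimators *)
    (F : nat -> Omega -> 'rV[R]_q -> R)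
    (hF : forall n w theta, F n w theta =
       empirical_contrast (realized_cov (h n) n (X ^~ w))
                          (Sigma (sem_at M theta)))
    (hat tilde check : nat -> Omega -> 'rV[R]_q)
    (mhat : forall n, random_vector (hat n))
    (mtilde : forall n, random_vector (tilde n))
    (mcheck : forall n, random_vector (check n))
    (hhat : forall n w, is_minimizer (F n w) Theta (hat n w))
    (htilde : forall n w, is_minimizer
       (penalized_ls (l1 n) (l2 n) gamma delta (hat n w)) Theta (tilde n w))
    (hcheck : forall n w, is_minimizer
       (F n w) (restrict_support Theta (tilde n w)) (check n w))
    (* misspecification and pseudo-true value *)
    (H1 : forall theta, Theta theta -> Sigma true_sem <> Sigma (sem_at M theta))
    (U : 'rV[R]_q -> R)
    (hU : forall theta,
       U theta = contrast (Sigma true_sem) (Sigma (sem_at M theta)))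
    (bar : 'rV[R]_q) (hbar : is_minimizer U Theta bar)
    (hbar_uniq : forall theta, is_minimizer U Theta theta -> theta = bar)
    (hhess : hessian U bar \in unitmx)
    (hbar_delta : forall j, j \in active bar -> delta < `|bar 0 j|)
    (* asymptotics *)
    (lim_h : h n @[n --> \oo] --> 0)
    (lim_nh : n%:R * h n @[n --> \oo] --> +oo)
    (lim_nh2 : n%:R * h n ^+ 2 @[n --> \oo] --> 0)
    (lim_l1 : Num.sqrt n%:R * l1 n @[n --> \oo] --> 0)
    (lim_l2 : Num.sqrt n%:R * l2 n @[n --> \oo] --> +oo) :
  P [set w | chi2_upper
               (((p1 + p2) * (p1 + p2).+1)./2 - #|active (tilde n w)|) alpha
             < n%:R * F n w (check n w)] @[n --> \oo] --> 1%E.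
Proof.
set s := true_sem in hadm0 H1 hU *.
have es : s = Sem L10 L20 G0 (1%:M - B0)
  (S1 *m S1^T) (S2 *m S2^T) (S3 *m S3^T) (S4 *m S4^T) by [].
have e1 : Sxi s = S1 *m S1^T by rewrite es.
have e2 : Sdelta s = S2 *m S2^T by rewrite es.
have e3 : Seps s = S3 *m S3^T by rewrite es.
have e4 : Szeta s = S4 *m S4^T by rewrite es.
have uP : Psi s \in unitmx by case: hadm0 => _ [].
have hX' t w : 0 <= t -> X t w = stacked_load s *m
    col_mx (col_mx (xi0 t w) (delta0 t w)) (col_mx (eps0 t w) (zeta0 t w)).
  move=> t0; have heta' : eta0 t w =
      (1%:M - Psi s) *m eta0 t w + Gam s *m xi0 t w + zeta0 t w.
    by rewrite es /= subKr; exact: heta.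
  by rewrite hX // -(observation_stacked_load _ _ uP heta') es.
have pS0 := pdmx_Sigma hadm0.
have [bar_Theta bar_min] := hbar.
have c0 : 0 < U bar.
  rewrite hU; apply: contrast_gt0 => //; [exact/pdmx_Sigma/hadm|exact: H1].
have [B hB] := invmx_Sigma_bounded hcomp hadm.
have [e e0 he] := contrast_near_lower_bound (pdmx_det_gt0 pS0) c0
  (fun t i j => @hB t i j) (fun t ht => eq_ind _ (fun x => U bar <= x) (bar_min t ht) _ (hU t)).
have [C hC] := realized_cov_mean_le hW1 hW2 hW3 hW4 hW hxi hdelta0 heps hzeta
  hB1 hB2 hB3 hB4 hm1 hm2 hm3 hm4 e1 e2 e3 e4 hX'.
pose N := ((p1 + p2) * (p1 + p2).+1)./2.
(* Truncated subtraction keeps the degrees of freedom between 0 and [N] whatever the random support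
   is, so this deterministic sum dominates every critical value, the default one at 0 included. *)
pose b := \sum_(r < N.+1) `|chi2_upper r alpha|.
have hb k : chi2_upper (N - k) alpha <= b.
  have Nk : (N - k < N.+1)%N by rewrite ltnS leq_subr.
  rewrite /b (bigD1 (Ordinal Nk)) //=; apply: le_trans (ler_norm _) _.
  by rewrite lerDl sumr_ge0.
apply: (probability_cvg1 (C := C) (e := e) (r := fun n => (Num.sqrt n%:R)^-1 + Num.sqrt (h n))) => //.
- move=> n; rewrite -[X in measurable X]setTI.
  have mb := measurable_active (fun k => chi2_upper (N - k) alpha) (mtilde n).
  have mF : measurable_fun setT (fun w => n%:R * F n w (check n w)).
    apply: measurable_funM => //.
    under eq_fun do rewrite hF; apply: measurable_empirical_contrast.
      exact: (random_vector_realized_cov hxi hdelta0 heps hzeta hX' n (ltW (hh n))).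
    exact: random_vector_sem_at.
  exact: (measurable_fun_ltr mb mF).
- exact: rate_cvg0.
near=> n.
have n0 : (0 < n)%N by near: n; exact: nbhs_infty_gt.
have hn1 : h n <= 1.
  apply: ltW; near: n; exact: (cvgr_lt 0 lim_h).
(* From this rank on [n] times the surviving margin [U bar / 2] exceeds [b]. *)
have nb : b / (U bar / 2) < n%:R by near: n; exact: nbhs_infty_gtr.
have [g mg hg] := hC n (h n) n0 (introT andP (conj (hh n) hn1)).
exists g => // w gw /=.
(* [uQ] selects the log-determinant branch of [empirical_contrast]; [lQ] bounds it below on all of
   [Theta]. *)
have [uQ lQ] := he (realized_cov (h n) n (X ^~ w)) (fun i j => le_lt_trans (hg w i j) gw).
have [[check_Theta _] _] := hcheck n w.
apply: le_lt_trans (hb _) _; rewrite hF /empirical_contrast uQ.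
have := lQ _ check_Theta; move: nb; rewrite ltr_pdivrMr ?divr_gt0 // => nb lc.
by apply: lt_le_trans nb _; rewrite ler_pM2l // ltr0n.
Unshelve. all: by end_near.
Qed.
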